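(* Let $H$ be a Hilbert module over a $C^*$-algebra. For every two idempotents $Q_1,Q_2\in\mathcal{L}(H)$, with matched projections $m(Q_1)$ and $m(Q_2)$, we have $$\|m(Q_1)-m(Q_2)\|=\inf_{m,n\in \mathbb{N}}\alpha_{m,n}=\inf_{m\in\mathbb{N}} \beta_m=\inf_{n\in\mathbb{N}} \gamma_n,$$ where for positive integers $m,n$, $$\alpha_{m,n}=\left\|\left[m(Q_1)Q_1m(Q_1)\right]^{\frac1m}-\left[m(Q_2)Q_2m(Q_2)\right]^{\frac1n}\right\|,$$ $$\beta_m=\left\|\left[m(Q_1)Q_1m(Q_1)\right]^{\frac1m}-m(Q_2)\right\|,\qquad \gamma_n=\left\|m(Q_1)-\left[m(Q_2)Q_2m(Q_2)\right]^{\frac1n}\right\|.$$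
   Context: $\mathcal{L}(H)$ is the $C^*$-algebra of adjointable operators on the Hilbert $C^*$-module $H$, and $I$ is the identity operator on $H$. $\mathcal{R}(\cdot)$ and $\mathcal{N}(\cdot)$ denote range and null space. An idempotent is $Q\in\mathcal{L}(H)$ with $Q^2=Q$; a projection is a self-adjoint idempotent. $P_{\mathcal{R}(Q)}$ is the projection of $H$ onto the (orthogonally complemented) range of $Q$. The symbol $m$ is used both for an integer index and for the matched projection $m(\cdot)$ defined next. For every idempotent $Q$ the operator $m(Q)Qm(Q)$ is positive, and fractional powers are those of positive elements of the $C^*$-algebra $\mathcal{L}(H)$. Definition of the matched projection $m(Q)$ of an idempotent $Q\in\mathcal{L}(H)$: if $Q$ is a projection, $m(Q)=Q$. Otherwise, $H=\mathcal{R}(Q)\dotplus\mathcal{N}(Q^* )$ is an orthogonal decomposition; let $U:H\to\mathcal{R}(Q)\oplus\mathcal{N}(Q^* )$ be the unitary $Uh=\binom{P_{\mathcal{R}(Q)}h}{(I-P_{\mathcal{R}(Q)})h}$, let $I_1$ be the identity on $\mathcal{R}(Q)$, let $A=(Q-P_{\mathcal{R}(Q)})|_{\mathcal{N}(Q^* )}:\mathcal{N}(Q^* )\to\mathcal{R}(Q)$ and $B=(AA^*+I_1)^{1/2}$, and set $$m(Q)=U^*\cdot\frac12\begin{pmatrix}(B+I_1)B^{-1} & B^{-1}A\\ A^*B^{-1} & A^*[B(B+I_1)]^{-1}A\end{pmatrix}\cdot U .$$ *)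

(* Defs.v *)
From HB Require Import structures.
From mathcomp Require Import all_boot all_order all_algebra.
From mathcomp Require Import all_classical all_reals.
From mathcomp Require Import topology normedtype.
From mathcomp Require Import complex.

Set Implicit Arguments.
Unset Strict Implicit.
Unset Printing Implicit Defensive.

Import Order.TTheory GRing.Theory Num.Theory.
Import numFieldNormedType.Exports.

Local Open Scope classical_set_scope.
Local Open Scope ring_scope.

(* C*-algebras are complex and not assumed to have a unit, hence the separate
   multiplication [cmul] (MathComp rings are unital). *)
HB.mixin Record isCStarAlgebra (R : realType) A
    of CompleteNormedModule R[i] A := {
  cmul : A -> A -> A ;
  cstar : A -> A ;
  cmulA : associative cmul ;
  cmulDl : left_distributive cmul +%R ;
  cmulDr : right_distributive cmul +%R ;
  cmulZl : forall (z : R[i]) (a b : A), cmul (z *: a) b = z *: cmul a b ;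
  cmulZr : forall (z : R[i]) (a b : A), cmul a (z *: b) = z *: cmul a b ;
  cstarK : involutive cstar ;
  cstarD : {morph cstar : a b / a + b} ;
  cstarZ : forall (z : R[i]) (a : A), cstar (z *: a) = Num.conj z *: cstar a ;
  cstarM : forall a b : A, cstar (cmul a b) = cmul (cstar b) (cstar a) ;
  norm_cmul_le : forall a b : A, `|cmul a b| <= `|a| * `|b| ;
  norm_cstar_cmul : forall a : A, `|cmul (cstar a) a| = `|a| ^+ 2
}.

#[short(type="cstarAlgType")]
HB.structure Definition CStarAlgebra (R : realType) :=
  {A of isCStarAlgebra R A & CompleteNormedModule R[i] A}.

Definition cpositive (R : realType) (A : cstarAlgType R) (a : A) : Prop :=
  exists b : A, a = cmul (cstar b) b.

(* Right inner-product modules; the inner product is linear in the second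
   variable. *)
HB.mixin Record isInnerModule (R : realType) (A : cstarAlgType R) E
    of GRing.Lmodule R[i] E := {
  ract : E -> A -> E ;
  inner : E -> E -> A ;
  ractDl : forall x y a, ract (x + y) a = ract x a + ract y a ;
  ractDr : forall x a b, ract x (a + b) = ract x a + ract x b ;
  ractA : forall x a b, ract (ract x a) b = ract x (cmul a b) ;
  ractZl : forall (z : R[i]) x a, ract (z *: x) a = z *: ract x a ;
  ractZr : forall (z : R[i]) x a, ract x (z *: a) = z *: ract x a ;
  innerDr : forall x y y', inner x (y + y') = inner x y + inner x y' ;
  innerZr : forall (z : R[i]) x y, inner x (z *: y) = z *: inner x y ;
  innerMr : forall x y a, inner x (ract y a) = cmul (inner x y) a ;
  inner_star : forall x y, cstar (inner x y) = inner y x ;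
  inner_ge0 : forall x, cpositive (inner x x) ;
  inner_eq0 : forall x, inner x x = 0 -> x = 0
}.

#[short(type="innerModType")]
HB.structure Definition InnerModule (R : realType) (A : cstarAlgType R) :=
  {E of isInnerModule R A E & GRing.Lmodule R[i] E}.

HB.mixin Record isHilbertModule (R : realType) (A : cstarAlgType R) H
    of CompleteNormedModule R[i] H & InnerModule R A H := {
  norm_inner : forall x : H, `|x| ^+ 2 = `|inner x x|
}.

#[short(type="hilbertModType")]
HB.structure Definition HilbertModule (R : realType) (A : cstarAlgType R) :=
  {H of isHilbertModule R A H & CompleteNormedModule R[i] H
      & InnerModule R A H}.

Section InnerTheory.
Variables (R : realType) (A : cstarAlgType R) (E : innerModType A).
Implicit Types x y : E.

Lemma innerDl x x' y : inner (x + x') y = inner x y + inner x' y.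
Proof. by rewrite -inner_star innerDr cstarD !inner_star. Qed.

Lemma innerZl z x y : inner (z *: x) y = Num.conj z *: inner x y.
Proof. by rewrite -inner_star innerZr cstarZ inner_star. Qed.

Lemma inner0r x : inner x 0 = 0.
Proof. by rewrite -(scale0r (0 : E)) innerZr scale0r. Qed.

Lemma inner0l x : inner 0 x = 0.
Proof. by rewrite -(scale0r (0 : E)) innerZl conjC0 scale0r. Qed.

Lemma ract0l a : ract (0 : E) a = 0.
Proof. by rewrite -(scale0r (0 : E)) ractZl !scale0r. Qed.

Lemma innerMl x a y : inner (ract x a) y = cmul (cstar a) (inner x y).
Proof. by rewrite -inner_star innerMr cstarM inner_star. Qed.

Lemma inner_inj x y : (forall z, inner z x = inner z y) -> x = y.
Proof.
move=> exy; apply/subr0_eq/inner_eq0.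
by rewrite innerDr -(scaleN1r y) innerZr exy [X in _ + X]scaleN1r subrr.
Qed.

End InnerTheory.

(* Adjointable maps: linearity, A-linearity and (between Hilbert modules)
   boundedness are consequences of the existence of an adjoint. *)
Record adjop (R : realType) (A : cstarAlgType R) (E F : innerModType A) := AdjOp {
  adjop_fun :> E -> F ;
  adjopP : exists S : F -> E, forall x y, inner (adjop_fun x) y = inner x (S y)
}.

Notation "''L' ( E , F )" := (adjop E F)
  (at level 8, format "''L' ( E ,  F )") : type_scope.
Notation "''L' ( E )" := (adjop E E)
  (at level 8, format "''L' ( E )") : type_scope.

HB.instance Definition _ (R : realType) (A : cstarAlgType R)
  (E F : innerModType A) := gen_eqMixin 'L(E, F).
HB.instance Definition _ (R : realType) (A : cstarAlgType R)
  (E F : innerModType A) := gen_choiceMixin 'L(E, F).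

Section Adjop.
Variables (R : realType) (A : cstarAlgType R).
Implicit Types E F G : innerModType A.

Lemma adjop_ext E F (S T : 'L(E, F)) : S =1 T -> S = T.
Proof.
case: S T => [S hS] [T hT] /= /funext eST.
by case: _ / eST in hT *; congr AdjOp; exact: Prop_irrelevance.
Qed.

Definition adjoint_fun E F (T : 'L(E, F)) : F -> E := projT1 (cid (adjopP T)).

Lemma adjoint_funP E F (T : 'L(E, F)) x y :
  inner (T x) y = inner x (adjoint_fun T y).
Proof. exact: (projT2 (cid (adjopP T))). Qed.

Lemma adjoint_fun_adjointable E F (T : 'L(E, F)) :
  exists S : E -> F, forall y x, inner (adjoint_fun T y) x = inner y (S x).
Proof. by exists T => y x; rewrite -inner_star -adjoint_funP inner_star. Qed.

Definition adj E F (T : 'L(E, F)) : 'L(F, E) :=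
  AdjOp (adjoint_fun_adjointable T).

Lemma adjP E F (T : 'L(E, F)) x y : inner (T x) y = inner x (adj T y).
Proof. exact: adjoint_funP. Qed.

Lemma adjPr E F (T : 'L(E, F)) x y : inner y (T x) = inner (adj T y) x.
Proof. by rewrite -inner_star adjP inner_star. Qed.

Lemma adjopD E F (T : 'L(E, F)) : {morph T : x y / x + y}.
Proof.
by move=> x y; apply: inner_inj => z; rewrite !(innerDr, adjPr).
Qed.

Lemma adjopZ E F (T : 'L(E, F)) (z : R[i]) x : T (z *: x) = z *: T x.
Proof. by apply: inner_inj => w; rewrite !(innerZr, adjPr). Qed.

Lemma adjopM E F (T : 'L(E, F)) x a : T (ract x a) = ract (T x) a.
Proof. by apply: inner_inj => w; rewrite !(innerMr, adjPr). Qed.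

Lemma adjop0 E F (T : 'L(E, F)) : T 0 = 0.
Proof. by rewrite -(scale0r (0 : E)) adjopZ scale0r. Qed.

Lemma zero_adjointable E F :
  exists S : F -> E, forall x y, inner ((fun=> 0) x : F) y = inner x (S y).
Proof. by exists (fun=> 0) => x y; rewrite inner0l inner0r. Qed.

Lemma id_adjointable E :
  exists S : E -> E, forall x y, inner (idfun x) y = inner x (S y).
Proof. by exists idfun. Qed.

Lemma add_adjointable E F (S T : 'L(E, F)) :
  exists U : F -> E, forall x y, inner (S x + T x) y = inner x (U y).
Proof.
by exists (fun y => adj S y + adj T y) => x y; rewrite innerDl innerDr !adjP.
Qed.

Lemma scale_adjointable E F (z : R[i]) (T : 'L(E, F)) :
  exists U : F -> E, forall x y, inner (z *: T x) y = inner x (U y).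
Proof.
by exists (fun y => Num.conj z *: adj T y) => x y; rewrite innerZl innerZr adjP.
Qed.

Lemma comp_adjointable E F G (S : 'L(F, G)) (T : 'L(E, F)) :
  exists U : G -> E, forall x y, inner (S (T x)) y = inner x (U y).
Proof. by exists (fun y => adj T (adj S y)) => x y; rewrite !adjP. Qed.

Definition zero_adjop E F : 'L(E, F) := AdjOp (zero_adjointable E F).
Definition id_adjop E : 'L(E) := AdjOp (id_adjointable E).
Definition add_adjop E F (S T : 'L(E, F)) := AdjOp (add_adjointable S T).
Definition scale_adjop E F z (T : 'L(E, F)) := AdjOp (scale_adjointable z T).
Definition opp_adjop E F (T : 'L(E, F)) := scale_adjop (-1) T.
Definition comp_adjop E F G (S : 'L(F, G)) (T : 'L(E, F)) : 'L(E, G) :=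
  AdjOp (comp_adjointable S T).

Fact add_adjopA E F : associative (@add_adjop E F).
Proof. by move=> S T U; apply: adjop_ext => x /=; rewrite addrA. Qed.

Fact add_adjopC E F : commutative (@add_adjop E F).
Proof. by move=> S T; apply: adjop_ext => x /=; rewrite addrC. Qed.

Fact add_0adjop E F : left_id (@zero_adjop E F) (@add_adjop E F).
Proof. by move=> T; apply: adjop_ext => x /=; rewrite add0r. Qed.

Fact add_Nadjop E F :
  left_inverse (@zero_adjop E F) (@opp_adjop E F) (@add_adjop E F).
Proof. by move=> T; apply: adjop_ext => x /=; rewrite scaleN1r addNr. Qed.

HB.instance Definition _ E F := GRing.isZmodule.Build 'L(E, F)
  (@add_adjopA E F) (@add_adjopC E F) (@add_0adjop E F) (@add_Nadjop E F).

Fact scale_adjopA E F (a b : R[i]) (T : 'L(E, F)) :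
  scale_adjop a (scale_adjop b T) = scale_adjop (a * b) T.
Proof. by apply: adjop_ext => x /=; rewrite scalerA. Qed.

Fact scale_1adjop E F : left_id 1 (@scale_adjop E F).
Proof. by move=> T; apply: adjop_ext => x /=; rewrite scale1r. Qed.

Fact scale_adjopDr E F : right_distributive (@scale_adjop E F) +%R.
Proof. by move=> a S T; apply: adjop_ext => x /=; rewrite scalerDr. Qed.

Fact scale_adjopDl E F (T : 'L(E, F)) :
  {morph (@scale_adjop E F)^~ T : a b / a + b}.
Proof. by move=> a b; apply: adjop_ext => x /=; rewrite scalerDl. Qed.

HB.instance Definition _ E F := GRing.Zmodule_isLmodule.Build R[i] 'L(E, F)
  (@scale_adjopA E F) (@scale_1adjop E F) (@scale_adjopDr E F)
  (@scale_adjopDl E F).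

Fact comp_adjopA E : associative (@comp_adjop E E E).
Proof. by move=> S T U; apply: adjop_ext. Qed.

Fact comp_1adjop E : left_id (id_adjop E) (@comp_adjop E E E).
Proof. by move=> T; apply: adjop_ext. Qed.

Fact comp_adjop1 E : right_id (id_adjop E) (@comp_adjop E E E).
Proof. by move=> T; apply: adjop_ext. Qed.

Fact comp_adjopDl E : left_distributive (@comp_adjop E E E) +%R.
Proof. by move=> S T U; apply: adjop_ext. Qed.

Fact comp_adjopDr E : right_distributive (@comp_adjop E E E) +%R.
Proof. by move=> S T U; apply: adjop_ext => x /=; rewrite adjopD. Qed.

HB.instance Definition _ E := GRing.Zmodule_isPzRing.Build 'L(E)
  (@comp_adjopA E) (@comp_1adjop E) (@comp_adjop1 E)
  (@comp_adjopDl E) (@comp_adjopDr E).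

End Adjop.

Notation "S \oL T" := (comp_adjop S T)
  (at level 40, left associativity, format "S  \oL  T") : ring_scope.
Notation "T ^†" := (adj T) (at level 2, format "T ^†") : ring_scope.

Section Submodules.
Variables (R : realType) (A : cstarAlgType R).

Record submodule (E : innerModType A) := Submodule {
  submod_set :> set E ;
  submod_set0 : submod_set 0 ;
  submod_setD : forall x y, submod_set x -> submod_set y -> submod_set (x + y) ;
  submod_setZ : forall (z : R[i]) x, submod_set x -> submod_set (z *: x) ;
  submod_setM : forall x a, submod_set x -> submod_set (ract x a)
}.

Definition submod_pred (E : innerModType A) (M : submodule E) : {pred E} :=
  fun x => `[< submod_set M x >].

Record submod_of (E : innerModType A) (M : submodule E) := SubmodOf {
  submod_val :> E ;
  submod_valP : submod_pred M submod_val
}.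

End Submodules.

HB.instance Definition _ (R : realType) (A : cstarAlgType R)
    (E : innerModType A) (M : submodule E) :=
  [isSub for @submod_val R A E M].
HB.instance Definition _ (R : realType) (A : cstarAlgType R)
    (E : innerModType A) (M : submodule E) :=
  [Choice of submod_of M by <:].

Section SubmodInstance.
Variables (R : realType) (A : cstarAlgType R) (E : innerModType A).
Variable M : submodule E.

Fact submod_pred_closed : submod_closed (submod_pred M).
Proof.
split; first exact/asboolP/submod_set0.
move=> z x y /asboolP Mx /asboolP My; apply/asboolP.
by apply: submod_setD => //; exact: submod_setZ.
Qed.

HB.instance Definition _ :=
  GRing.SubChoice_isSubLmodule.Build R[i] E (submod_pred M) (submod_of M)
    submod_pred_closed.

Definition submod_ract (x : submod_of M) (a : A) : submod_of M :=
  SubmodOf (asboolT (submod_setM a (asboolW (submod_valP x)))).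
Definition submod_inner (x y : submod_of M) : A := inner (val x) (val y).

Fact submod_ractDl x y a :
  submod_ract (x + y) a = submod_ract x a + submod_ract y a.
Proof. by apply: val_inj; rewrite /= ractDl. Qed.

Fact submod_ractDr x a b :
  submod_ract x (a + b) = submod_ract x a + submod_ract x b.
Proof. by apply: val_inj; rewrite /= ractDr. Qed.

Fact submod_ractA x a b :
  submod_ract (submod_ract x a) b = submod_ract x (cmul a b).
Proof. by apply: val_inj; rewrite /= ractA. Qed.

Fact submod_ractZl (z : R[i]) x a :
  submod_ract (z *: x) a = z *: submod_ract x a.
Proof. by apply: val_inj; rewrite /= ractZl. Qed.

Fact submod_ractZr (z : R[i]) x a :
  submod_ract x (z *: a) = z *: submod_ract x a.
Proof. by apply: val_inj; rewrite /= ractZr. Qed.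

Fact submod_innerDr x y y' :
  submod_inner x (y + y') = submod_inner x y + submod_inner x y'.
Proof. exact: innerDr. Qed.

Fact submod_innerZr (z : R[i]) x y :
  submod_inner x (z *: y) = z *: submod_inner x y.
Proof. exact: innerZr. Qed.

Fact submod_innerMr x y a :
  submod_inner x (submod_ract y a) = cmul (submod_inner x y) a.
Proof. exact: innerMr. Qed.

Fact submod_inner_star x y : cstar (submod_inner x y) = submod_inner y x.
Proof. exact: inner_star. Qed.

Fact submod_inner_ge0 x : cpositive (submod_inner x x).
Proof. exact: inner_ge0. Qed.

Fact submod_inner_eq0 x : submod_inner x x = 0 -> x = 0.
Proof. by move=> /inner_eq0 x0; apply: val_inj. Qed.

HB.instance Definition _ := isInnerModule.Build R A (submod_of M)
  submod_ractDl submod_ractDr submod_ractA submod_ractZl submod_ractZr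
  submod_innerDr submod_innerZr submod_innerMr submod_inner_star
  submod_inner_ge0 submod_inner_eq0.

End SubmodInstance.

Section Operators.
Variables (R : realType) (A : cstarAlgType R).
Implicit Types E F : innerModType A.

Definition rangeL E F (T : 'L(E, F)) : submodule F.
Proof.
apply: (@Submodule _ _ _ (range T)).
- by exists 0 => //; rewrite adjop0.
- by move=> _ _ [x _ <-] [y _ <-]; exists (x + y) => //; rewrite adjopD.
- by move=> z _ [x _ <-]; exists (z *: x) => //; rewrite adjopZ.
- by move=> _ a [x _ <-]; exists (ract x a) => //; rewrite adjopM.
Defined.

Definition nullL E F (T : 'L(E, F)) : submodule E.
Proof.
apply: (@Submodule _ _ _ [set x | T x = 0]).
- exact: adjop0.
- by move=> x y /= Tx Ty; rewrite adjopD Tx Ty addr0.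
- by move=> z x /= Tx; rewrite adjopZ Tx scaler0.
- by move=> x a /= Tx; rewrite adjopM Tx ract0l.
Defined.

Definition idempotentL E (Q : 'L(E)) : Prop := Q * Q = Q.

Definition projectionL E (P : 'L(E)) : Prop := idempotentL P /\ P^† = P.

Definition positiveL E (T : 'L(E)) : Prop := exists S : 'L(E), T = S^† * S.

(* T^(1/n), for n > 0: a positive element of the C*-algebra L(E), E a Hilbert
   module, has exactly one positive n-th root. Outside the intended domain,
   [xget] here and below falls back on its default value 0. *)
Definition rootL n E (T : 'L(E)) : 'L(E) :=
  xget 0 [set S : 'L(E) | positiveL S /\ S ^+ n = T].

Definition invL E (T : 'L(E)) : 'L(E) :=
  xget 0 [set S : 'L(E) | S * T = 1 /\ T * S = 1].

(* The orthogonal projection onto the range of T. *)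
Definition rprojL E (T : 'L(E)) : 'L(E) :=
  xget 0 [set P : 'L(E) | projectionL P /\ range P = range T].

(* T viewed as an operator from M to N, for T mapping M into N. *)
Definition restrL E (T : 'L(E)) (M N : submodule E) :
    'L(submod_of M, submod_of N) :=
  xget 0 [set S : 'L(submod_of M, submod_of N) |
            forall x, val (S x) = T (val x)].

(* T viewed as an operator with codomain N, for T with range in N. *)
Definition corestrL E F (T : 'L(E, F)) (N : submodule F) :
    'L(E, submod_of N) :=
  xget 0 [set S : 'L(E, submod_of N) | forall x, val (S x) = T x].

(* [[a, b], [c, d]] conjugated by U = (U1, U2) : E -> F (+) G, that is
   U^† [[a, b], [c, d]] U, where U^† (x, y) = U1^† x + U2^† y. *)
Definition block_conj E F G (U1 : 'L(E, F)) (U2 : 'L(E, G))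
    (a : 'L(F)) (b : 'L(G, F)) (c : 'L(F, G)) (d : 'L(G)) : 'L(E) :=
  U1^† \oL (a \oL U1 + b \oL U2) + U2^† \oL (c \oL U1 + d \oL U2).

Definition matched_proj_block E (Q : 'L(E)) : 'L(E) :=
  let P := rprojL Q in
  let U1 := corestrL P (rangeL Q) in
  let U2 := corestrL (1 - P) (nullL Q^†) in
  let A := restrL (Q - P) (nullL Q^†) (rangeL Q) in
  let B := rootL 2 (A \oL A^† + 1) in
  block_conj U1 U2
    (2^-1 *: ((B + 1) * invL B)) (2^-1 *: (invL B \oL A))
    (2^-1 *: (A^† \oL invL B))
    (2^-1 *: (A^† \oL invL (B * (B + 1)) \oL A)).

Definition matched_proj E (Q : 'L(E)) : 'L(E) :=
  if `[< projectionL Q >] then Q else matched_proj_block Q.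

(* The norm of a normedModType over R[i] takes its values in R[i]. *)
Definition normL (H K : hilbertModType A) (T : 'L(H, K)) : R :=
  sup [set complex.Re `|T x| | x in [set x : H | `|x| <= 1]].

End Operators.

(* Main.v *)
(* Put M = m(Q) and T = M Q M. In block form M = V V^* for an isometry V on
   R(Q), and T = V ((B + 1) / 2) V^* with B >= 1. Hence T >= M, the n-th root of
   T is S = Y M for some Y >= 1 commuting with M, and Bernoulli's inequality
   gives M <= S <= M + (T - M) / n, so the roots converge to M. Conversely, if
   S_i = Y_i M_i with Y_i >= 1, then
   |(1 - M_2) M_1| <= |(1 - M_2) S_1| = |(1 - M_2) (S_1 - S_2)| <= |S_1 - S_2|,
   and symmetrically; since |M_1 - M_2| is the larger of |(1 - M_2) M_1| and
   |(1 - M_1) M_2|, all the quantities under the infima are at least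
   |M_1 - M_2|.

   L(H) is a C*-algebra by the Cauchy-Schwarz inequality, which follows from the
   triangle inequality in H applied to the isometries
   theta +- i sqrt(1 - theta^2) with theta = x <x, .>, without using the order
   of A. *)

From HB Require Import structures.
Require Import Defs.
From mathcomp Require Import all_boot all_order all_algebra.
From mathcomp Require Import all_classical all_reals.
From mathcomp Require Import topology normedtype.
From mathcomp Require Import complex ring lra.

Set Implicit Arguments.
Unset Strict Implicit.
Unset Printing Implicit Defensive.

Import Order.TTheory GRing.Theory Num.Theory.
Import numFieldNormedType.Exports.

Local Open Scope classical_set_scope.
Local Open Scope ring_scope.

(** * Identities in free rings and free modules *)

(** Spectral theory is avoided: roots and inverses are fixed points of explicit iterations, and a
    bicommutant condition ([commutant]) travels with them in place of functional calculus, because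
    products of positive elements and the uniqueness of roots are handled here only for commuting
    elements. Positivity is a norm condition ([pos]); that it agrees with [positiveL] rests on
    [pos_starM]. The other obstacle is the block form. Each root or inverse on R(Q) is therefore
    built in L(H), with the identity filling the complement, and then compressed; uniqueness of
    roots goes the other way, by extending a candidate to L(H). Filling a corner with the identity
    is also what makes an element such as [T], which need not be invertible, accessible to the
    theory of elements above 1. *)

Inductive ncexp := NCvar of nat | NC0 | NC1 | NCadd of ncexp & ncexp
  | NCopp of ncexp | NCmul of ncexp & ncexp.

Fixpoint ncterms (e : ncexp) : seq (bool * seq nat) :=
  match e with
  | NCvar i => [:: (false, [:: i])]
  | NC0 => [::]
  | NC1 => [:: (false, [::])]
  | NCadd a b => ncterms a ++ ncterms b
  | NCopp a => [seq (~~ t.1, t.2) | t <- ncterms a]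
  | NCmul a b =>
      [seq (t.1 (+) u.1, t.2 ++ u.2) | t <- ncterms a, u <- ncterms b]
  end.

(** The fuel [n] makes the recursion structural: each step removes [t] and one opposite occurrence
    of it, and [rem] hides the decrease. *)
Fixpoint cancels (T : eqType) (n : nat) (s : seq (bool * T)) : bool :=
  match s, n with
  | [::], _ => true
  | t :: s', n'.+1 =>
      let t' := (~~ t.1, t.2) in (t' \in s') && cancels n' (rem t' s')
  | _, _ => false
  end.

Section Cancels.
Variables (T : eqType) (V : zmodType) (f : T -> V).

Definition signed_val (t : bool * T) : V := if t.1 then - f t.2 else f t.2.

Lemma signed_valN t : signed_val (~~ t.1, t.2) = - signed_val t.
Proof. by case: t => -[] x; rewrite /signed_val //= opprK. Qed.

Lemma cancels_sum n s : cancels n s -> \sum_(t <- s) signed_val t = 0.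
Proof.
elim: n s => [[]//|n IHn [|t s] /=]; rewrite ?big_nil // => /andP[ts /IHn s0].
rewrite big_cons (perm_big _ (perm_to_rem ts)) big_cons /= s0 addr0.
by rewrite signed_valN subrr.
Qed.

End Cancels.

Definition nceq (a b : ncexp) : bool :=
  let s := ncterms (NCadd a (NCopp b)) in cancels (size s) s.

Section NcringSound.
Variables (B : pzRingType) (env : seq B).

Fixpoint nceval (e : ncexp) : B :=
  match e with
  | NCvar i => env`_i
  | NC0 => 0
  | NC1 => 1
  | NCadd a b => nceval a + nceval b
  | NCopp a => - nceval a
  | NCmul a b => nceval a * nceval b
  end.

Let word_val (w : seq nat) : B := \prod_(i <- w) env`_i.

Lemma nceval_terms e : nceval e = \sum_(t <- ncterms e) signed_val word_val t.
Proof.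
elim: e => [i|||a IHa b IHb|a IHa|a IHa b IHb] /=.
- by rewrite big_seq1 /signed_val /word_val /= big_seq1.
- by rewrite big_nil.
- by rewrite big_seq1 /signed_val /word_val /= big_nil.
- by rewrite big_cat IHa IHb.
- by rewrite IHa big_map -sumrN; apply: eq_bigr => t _; rewrite signed_valN.
- rewrite IHa IHb big_allpairs_dep /= mulr_suml.
  apply: eq_bigr => -[s w] _; rewrite mulr_sumr.
  apply: eq_bigr => -[s' w'] _; rewrite /signed_val /word_val /= big_cat.
  by case: s; case: s'; rewrite /= ?mulNr ?mulrN ?opprK.
Qed.

Lemma nceq_sound a b : nceq a b -> nceval a = nceval b.
Proof.
move/(cancels_sum word_val); rewrite -nceval_terms /= => /eqP.
by rewrite subr_eq0 => /eqP.
Qed.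

End NcringSound.

Inductive zexp := Zvar of nat | Z0 | Zadd of zexp & zexp | Zopp of zexp.

Fixpoint zterms (e : zexp) : seq (bool * nat) :=
  match e with
  | Zvar i => [:: (false, i)]
  | Z0 => [::]
  | Zadd a b => zterms a ++ zterms b
  | Zopp a => [seq (~~ t.1, t.2) | t <- zterms a]
  end.

Definition zeq (a b : zexp) : bool :=
  let s := zterms (Zadd a (Zopp b)) in cancels (size s) s.

Section ZmodSound.
Variables (V : zmodType) (env : seq V).

Fixpoint zeval (e : zexp) : V :=
  match e with
  | Zvar i => env`_i
  | Z0 => 0
  | Zadd a b => zeval a + zeval b
  | Zopp a => - zeval a
  end.

Lemma zeval_terms e : zeval e = \sum_(t <- zterms e) signed_val (nth 0 env) t.
Proof.
elim: e => [i||a IHa b IHb|a IHa] /=.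
- by rewrite big_seq1.
- by rewrite big_nil.
- by rewrite big_cat IHa IHb.
- by rewrite IHa big_map -sumrN; apply: eq_bigr => t _; rewrite signed_valN.
Qed.

Lemma zeq_sound a b : zeq a b -> zeval a = zeval b.
Proof.
move/(cancels_sum (nth 0 env)); rewrite -zeval_terms /= => /eqP.
by rewrite subr_eq0 => /eqP.
Qed.

End ZmodSound.

Ltac nc_index x l :=
  match l with
  | x :: _ => constr:(0%N)
  | _ :: ?t => let n := nc_index x t in constr:(n.+1)
  end.

Ltac nc_add x l :=
  match l with
  | context [x :: _] => l
  | _ => constr:(x :: l)
  end.

Ltac nc_atoms e l :=
  match e with
  | (?a + ?b)%R => let l' := nc_atoms a l in nc_atoms b l'
  | (- ?a)%R => nc_atoms a l
  | (?a * ?b)%R => let l' := nc_atoms a l in nc_atoms b l'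
  | 0%R => l
  | 1%R => l
  | _ => nc_add e l
  end.

Ltac nc_quote e l :=
  match e with
  | (?a + ?b)%R =>
      let a' := nc_quote a l in let b' := nc_quote b l in constr:(NCadd a' b')
  | (- ?a)%R => let a' := nc_quote a l in constr:(NCopp a')
  | (?a * ?b)%R =>
      let a' := nc_quote a l in let b' := nc_quote b l in constr:(NCmul a' b')
  | 0%R => constr:(NC0)
  | 1%R => constr:(NC1)
  | _ => let i := nc_index e l in constr:(NCvar i)
  end.

(* Only identities that hold without commutation between the atoms. *)
Ltac ncring :=
  match goal with
  | |- @eq ?T ?a ?b =>
      let l := nc_atoms a (@nil T) in
      let l := nc_atoms b l in
      let ea := nc_quote a l in
      let eb := nc_quote b l in
      change (nceval l ea = nceval l eb);
      apply: nceq_sound; vm_compute; reflexivity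
  end.

Ltac z_atoms e l :=
  match e with
  | (?a + ?b)%R => let l' := z_atoms a l in z_atoms b l'
  | (- ?a)%R => z_atoms a l
  | 0%R => l
  | _ => nc_add e l
  end.

Ltac z_quote e l :=
  match e with
  | (?a + ?b)%R =>
      let a' := z_quote a l in let b' := z_quote b l in constr:(Zadd a' b')
  | (- ?a)%R => let a' := z_quote a l in constr:(Zopp a')
  | 0%R => constr:(Z0)
  | _ => let i := nc_index e l in constr:(Zvar i)
  end.

Ltac zmodule :=
  match goal with
  | |- @eq ?T ?a ?b =>
      let l := z_atoms a (@nil T) in
      let l := z_atoms b l in
      let ea := z_quote a l in
      let eb := z_quote b l in
      change (zeval l ea = zeval l eb);
      apply: zeq_sound; vm_compute; reflexivity
  end.

(** * Convergence for real-valued seminorms *)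

Section Convergence.
Variables (R : realType) (V : zmodType) (N : V -> R).

(** Stated for a bare real-valued [N], so that the same lemmas serve [A], [H] and L(H), the last of
    which is given no topology. *)
Definition ncvg (u : nat -> V) (l : V) : Prop :=
  forall e, 0 < e -> exists n0, forall n, (n0 <= n)%N -> N (u n - l) <= e.

Definition ncauchy (u : nat -> V) : Prop :=
  forall e, 0 < e -> exists n0, forall m n, (n0 <= m)%N -> (n0 <= n)%N ->
  N (u m - u n) <= e.

Definition ncomplete : Prop := forall u, ncauchy u -> exists l, ncvg u l.

Hypothesis ND : forall a b, N (a + b) <= N a + N b.
Hypothesis NN : forall a, N (- a) = N a.
Hypothesis N0 : N 0 = 0.
Hypothesis Ncomplete : ncomplete.

Lemma seminorm_ge0 a : 0 <= N a.
Proof. by have := ND a (- a); rewrite subrr N0 NN -mulr2n pmulrn_lge0. Qed.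

Lemma seminorm_distB a b c : N (a - c) <= N (a - b) + N (b - c).
Proof. by rewrite -[a - c](subrKA b) ND. Qed.

Lemma ncvg_le u l c : (forall n, N (u n) <= c) -> ncvg u l -> N l <= c.
Proof.
move=> uc ul; apply/ler_addgt0Pr => e /ul[n0 /(_ _ (leqnn _)) h].
have := ND (u n0) (- (u n0 - l)); rewrite NN opprB [u n0 + _]addrC subrK.
by have := uc n0; lra.
Qed.

(** The increments of [z] dominate norms, so [z] is nondecreasing; being bounded it is Cauchy, and
    [u] inherits this. *)
Lemma majorant_cvg (u : nat -> V) (z : nat -> R) (c : R) :
  (forall n, N (u n.+1 - u n) <= z n.+1 - z n) -> (forall n, z n <= c) ->
  exists l, ncvg u l.
Proof.
move=> uz zc; apply: Ncomplete => e e0.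
have uzk m k : N (u (m + k)%N - u m) <= z (m + k)%N - z m.
  elim: k => [|k IHk]; first by rewrite addn0 !subrr N0.
  rewrite addnS; have := uz (m + k)%N.
  have := seminorm_distB (u (m + k).+1) (u (m + k)%N) (u m); lra.
have hs : has_sup (range z).
  by split; [exists (z 0), 0 | exists c => _ [n _ <-]].
have e20 : 0 < e / 2 by lra.
have [_ [n0 _ <-] hn0] := sup_adherent e20 hs.
have zn0 n : (n0 <= n)%N -> N (u n - u n0) <= e / 2.
  move=> /subnKC <-; apply: le_trans (uzk _ _) _.
  have : z (n0 + (n - n0))%N <= sup (range z).
    by apply: ub_le_sup; [exact: hs.2 | exists (n0 + (n - n0))%N].
  lra.
exists n0 => m n /zn0 hm /zn0 hn.
have := seminorm_distB (u m) (u n0) (u n); rewrite -(NN (u n0 - _)) opprB; lra.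
Qed.

Lemma majorant_tail (u : nat -> V) (z : nat -> R) (c : R) (l : V) (n : nat) :
    (forall n, N (u n.+1 - u n) <= z n.+1 - z n) -> (forall n, z n <= c) ->
  ncvg u l -> N (l - u n) <= c - z n.
Proof.
move=> uz zc ul; apply/ler_addgt0Pr => e /ul[n0 h].
have uzk k : N (u (n + k)%N - u n) <= z (n + k)%N - z n.
  elim: k => [|k IHk]; first by rewrite addn0 !subrr N0.
  rewrite addnS; have := uz (n + k)%N.
  have := seminorm_distB (u (n + k).+1) (u (n + k)%N) (u n); lra.
have := h _ (leq_addl n n0); rewrite -NN opprB; have := uzk n0.
have := seminorm_distB l (u (n + n0)%N) (u n); have := zc (n + n0)%N; lra.
Qed.

(** Banach's theorem on an invariant, sequentially closed [D]. Through [D] the fixed point acquires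
    commutation properties and order bounds. *)
Lemma contraction_fixpoint (F : V -> V) (D : V -> Prop) (k : R) (x0 : V) :
    (forall a, N a = 0 -> a = 0) ->
    0 <= k -> k < 1 -> D x0 -> (forall x, D x -> D (F x)) ->
    (forall u l, (forall n, D (u n)) -> ncvg u l -> D l) ->
    (forall x y, D x -> D y -> N (F x - F y) <= k * N (x - y)) ->
  exists2 l, D l & F l = l.
Proof.
move=> N_eq0 k0 k1 Dx0 DF Dcl Fk.
pose u n := iter n F x0; pose d := N (F x0 - x0).
have Du n : D (u n) by elim: n => //= n /DF.
have uk n : N (u n.+1 - u n) <= k ^+ n * d.
  elim: n => [|n IHn]; first by rewrite expr0 mul1r.
  apply: le_trans (Fk _ _ (Du n.+1) (Du n)) _.
  by rewrite exprS -mulrA ler_wpM2l.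
pose z n := \sum_(i < n) k ^+ i * d.
have d0 : 0 <= d := seminorm_ge0 _.
have zd n : z n <= d / (1 - k).
  rewrite ler_pdivlMr ?subr_gt0 // /z -mulr_suml mulrAC ler_piMl //.
  by rewrite mulrC -opprB mulNr -subrX1 opprB gerBl exprn_ge0.
have [l ul] : exists l, ncvg u l.
  apply: (majorant_cvg (z := z) (c := d / (1 - k))) => // n.
  by rewrite /z big_ord_recr [X in _ <= X - _]addrC addrK; apply: uk.
exists l; first exact: Dcl ul.
apply/subr0_eq/N_eq0/eqP; rewrite eq_le seminorm_ge0 andbT.
apply/ler_addgt0Pr => e e0; rewrite add0r; have e20 : 0 < e / 2 by lra.
have [n0 h] := ul _ e20.
have h1 := h _ (leqnn n0); have h2 := h _ (leqW (leqnn n0)).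
have := Fk _ _ (Dcl _ _ Du ul) (Du n0).
have := seminorm_distB (F l) (u n0.+1) l => /=.
rewrite -(NN (l - u _)) opprB; have := seminorm_ge0 (u n0 - l); nra.
Qed.

End Convergence.

Section SquareFixpoint.
Variables (R : realType) (V : zmodType) (N : V -> R).
(** [m] is the ring product in a unital C*-algebra, but the twisted product [a p c] in the possibly
    nonunital [A], where it replaces a square root of [1 - p]-type expressions. *)
Variables (half : V -> V) (m : V -> V -> V) (y : V) (D : V -> Prop).

(* Dominated by the scalar iteration [z <- (1 + z ^+ 2) / 2], which increases
   to [1]; this works up to the boundary case [N y = 1]. *)
Lemma half_square_fixpoint :
    (forall a b, N (a + b) <= N a + N b) -> (forall a, N (- a) = N a) ->
    N 0 = 0 -> (forall a, N a = 0 -> a = 0) -> ncomplete N ->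
    (forall a, half a + half a = a) ->
    (forall a b, half (a - b) = half a - half b) ->
    (forall a, N (half a) = N a / 2) ->
    (forall a b c, m (a - b) c = m a c - m b c) ->
    (forall a b c, m a (b - c) = m a b - m a c) ->
    (forall a b, N (m a b) <= N a * N b) -> N y <= 1 ->
    D 0 -> (forall a, D a -> D (half (y + m a a))) ->
    (forall u l, (forall n, D (u n)) -> ncvg N u l -> D l) ->
  exists2 w, D w & w + w = y + m w w.
Proof.
move=> ND NN N0 N_eq0 Ncomplete half_double halfB Nhalf mBl mBr Nm y1 D0 DF Dcl.
pose F a := half (y + m a a).
have N_ge0 := seminorm_ge0 ND NN N0.
have FB a b : N (F a - F b) <= N (a - b) * (N a + N b) / 2.
  rewrite /F -halfB Nhalf ler_pM2r ?invr_gt0 ?ltr0n //.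
  rewrite opprD addrACA subrr add0r.
  have -> : m a a - m b b = m (a - b) a + m b (a - b).
    by rewrite mBl mBr subrKA.
  have := ND (m (a - b) a) (m b (a - b)); have := Nm (a - b) a.
  by have := Nm b (a - b); lra.
pose u n := iter n F 0; pose z n := iter n (fun t : R => (1 + t ^+ 2) / 2) 0.
have zS n : z n.+1 = (1 + z n ^+ 2) / 2 by [].
have z01 n : 0 <= z n <= 1.
  by elim: n => [|n]; rewrite /z /= ?lexx ?ler01 //; move: (iter _ _ _) => t;
    nra.
have uz n : N (u n) <= z n.
  elim: n => [|n IHn]; first by rewrite /u /z /= N0.
  rewrite /u /z !iterS -/(u n) -/(z n) /F Nhalf.
  have := ND y (m (u n) (u n)); have := Nm (u n) (u n).
  have := N_ge0 (u n); have := z01 n; nra.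
have uzS n : N (u n.+1 - u n) <= z n.+1 - z n.
  elim: n => [|n IHn].
    have F0 : F 0 = half y.
      by rewrite /F -[X in m X _](subrr 0) mBl subrr addr0.
    by rewrite /u /z /= F0 subr0 Nhalf expr0n /=; lra.
  have := FB (u n.+1) (u n); have := uz n; have := uz n.+1.
  have := N_ge0 (u n.+1 - u n).
  have -> : z n.+2 - z n.+1 = (z n.+1 - z n) * (z n.+1 + z n) / 2.
    by rewrite (zS n.+1) [X in _ - X = _]zS; field.
  rewrite -[u n.+2 - u n.+1]/(F (u n.+1) - F (u n)).
  have := N_ge0 (u n); have := N_ge0 (u n.+1).
  move: (N (F _ - F _)) (N (u n.+1 - u n)) IHn => d d'; nra.
have [l ul] : exists l, ncvg N u l.
  apply: (majorant_cvg ND NN N0 Ncomplete (z := z) (c := 1)) => // n.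
  by have /andP[] := z01 n.
have Du n : D (u n) by elim: n => //= n /DF.
exists l; first exact: Dcl ul.
have u1 n : N (u n) <= 1 by have := uz n; have := z01 n; lra.
have l1 := ncvg_le ND NN u1 ul.
suff Fl : F l = l.
  by rewrite -[X in X + X]Fl /F half_double.
(* On the unit ball [FB] makes [F] merely nonexpansive, which still allows passing to the limit in
   [u n.+1 = F (u n)]. *)
apply/subr0_eq/N_eq0/eqP; rewrite eq_le N_ge0 andbT.
apply/ler_addgt0Pr => e e0; rewrite add0r; have e20 : 0 < e / 2 by lra.
have [n0 h] := ul _ e20.
have h1 := h _ (leqnn n0); have h2 := h _ (leqW (leqnn n0)).
have := FB l (u n0); have := u1 n0.
have := seminorm_distB ND (F l) (u n0.+1) l => /=.
rewrite -(NN (l - u _)) opprB; have := N_ge0 (u n0 - l).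
have := N_ge0 l; have := N_ge0 (u n0); nra.
Qed.

End SquareFixpoint.

(** * Unital C*-algebras *)

(* Scalars enter through the central embedding [scal] because MathComp algebras
   exclude the zero ring, which occurs here as L(0). *)
HB.mixin Record isUnitalCStar (R : realType) B of GRing.PzRing B := {
  star : B -> B ;
  scal : R[i] -> B ;
  unorm : B -> R ;
  scalD : {morph scal : y z / y + z} ;
  scalM : {morph scal : y z / y * z} ;
  scal1 : scal 1 = 1 ;
  scalC : forall z a, scal z * a = a * scal z ;
  starK : involutive star ;
  starD : {morph star : a b / a + b} ;
  starM : forall a b, star (a * b) = star b * star a ;
  star_scal : forall z : R[i], star (scal z) = scal (Num.conj z) ;
  unormD : forall a b, unorm (a + b) <= unorm a + unorm b ;
  unorm_scalM : forall z a, unorm (scal z * a) = complex.Re `|z| * unorm a ;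
  unormM : forall a b, unorm (a * b) <= unorm a * unorm b ;
  unorm_starM : forall a, unorm (star a * a) = unorm a ^+ 2 ;
  unorm_eq0 : forall a, unorm a = 0 -> a = 0 ;
  ucomplete : ncomplete unorm
}.

#[short(type="ucstarType")]
HB.structure Definition UnitalCStar (R : realType) :=
  {B of isUnitalCStar R B & GRing.PzRing B}.

Section UnitalCStarTheory.
Variables (R : realType) (B : ucstarType R).
Implicit Types a b c d h k S T X Y M P Q W : B.

Local Notation star := (@star R B).
Local Notation nrm := (@unorm R B).

Definition rs (t : R) : B := scal t%:C%C.
Definition im : B := scal 'i.

Lemma star0 : star 0 = 0.
Proof. by apply: (addrI (star 0)); rewrite -starD !addr0. Qed.

Lemma starN a : star (- a) = - star a.
Proof. by apply/eqP; rewrite -addr_eq0 -starD addNr star0. Qed.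

Lemma starB a b : star (a - b) = star a - star b.
Proof. by rewrite starD starN. Qed.

Lemma star1 : star 1 = 1.
Proof. by rewrite -[LHS]mul1r -[X in X * _]starK -starM mul1r starK. Qed.

Lemma rsD s t : rs (s + t) = rs s + rs t.
Proof. by rewrite /rs rmorphD scalD. Qed.

Lemma rsM s t : rs (s * t) = rs s * rs t.
Proof. by rewrite /rs rmorphM scalM. Qed.

Lemma rs1 : rs 1 = 1.
Proof. by rewrite /rs rmorph1 scal1. Qed.

Lemma rs0 : rs 0 = 0.
Proof. by apply: (addrI (rs 0)); rewrite -rsD !addr0. Qed.

Lemma rsN t : rs (- t) = - rs t.
Proof. by apply/eqP; rewrite -addr_eq0 -rsD addNr rs0. Qed.

Lemma rsB s t : rs (s - t) = rs s - rs t.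
Proof. by rewrite rsD rsN. Qed.

Lemma rsC t a : rs t * a = a * rs t.
Proof. exact: scalC. Qed.

Lemma star_rs t : star (rs t) = rs t.
Proof.
by rewrite /rs star_scal; congr scal; apply: CrealP; rewrite complex_real.
Qed.

Lemma imC a : im * a = a * im.
Proof. exact: scalC. Qed.

Lemma im2 : im * im = -1.
Proof. by rewrite /im -scalM -expr2 sqrCi -rs1 -rsN /rs rmorphN1. Qed.

Lemma star_im : star im = - im.
Proof.
rewrite /im star_scal conjCi; apply/eqP; rewrite -addr_eq0 -scalD addNr.
by have := rs0; rewrite /rs rmorph0 => ->.
Qed.

Lemma nrm_rs t a : nrm (rs t * a) = `|t| * nrm a.
Proof. by rewrite unorm_scalM normc_def /= expr0n addr0 sqrtr_sqr. Qed.

Lemma comm_rs t a : GRing.comm (rs t) a.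
Proof. exact: rsC. Qed.

Lemma comml_mul a b c : GRing.comm a c -> GRing.comm b c ->
  GRing.comm (a * b) c.
Proof. by move=> ac bc; rewrite /GRing.comm -mulrA bc !mulrA ac. Qed.

Lemma comml_add a b c : GRing.comm a c -> GRing.comm b c ->
  GRing.comm (a + b) c.
Proof. by move=> ac bc; rewrite /GRing.comm mulrDl mulrDr ac bc. Qed.

Lemma comml_sub a b c : GRing.comm a c -> GRing.comm b c ->
  GRing.comm (a - b) c.
Proof. by move=> ac bc; rewrite /GRing.comm mulrBl mulrBr ac bc. Qed.

Lemma comml_0 c : GRing.comm 0 c.
Proof. by rewrite /GRing.comm mul0r mulr0. Qed.

Lemma comml_1 c : GRing.comm 1 c.
Proof. by rewrite /GRing.comm mul1r mulr1. Qed.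

#[local] Hint Resolve comm_rs comml_1 : core.

Lemma nrmN a : nrm (- a) = nrm a.
Proof. by rewrite -mulN1r -rs1 -rsN nrm_rs normrN1 mul1r. Qed.

Lemma nrm0 : nrm 0 = 0.
Proof. by rewrite -(mul0r 0) -rs0 nrm_rs normr0 mul0r. Qed.

Lemma nrm_ge0 a : 0 <= nrm a.
Proof. exact: (seminorm_ge0 (@unormD R B) nrmN nrm0). Qed.

Lemma nrm_le0 a : nrm a <= 0 -> a = 0.
Proof.
by move=> a0; apply: (@unorm_eq0 R B); apply/eqP; rewrite eq_le a0 nrm_ge0.
Qed.

Lemma nrm_distC a b : nrm (a - b) = nrm (b - a).
Proof. by rewrite -nrmN opprB. Qed.

Lemma nrm1_le1 : nrm 1 <= 1.
Proof.
by have := unorm_starM (1 : B); rewrite star1 mulr1; have := nrm_ge0 1; nra.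
Qed.

Lemma nrm_rs1 t : nrm (rs t) <= `|t|.
Proof. by rewrite -[rs t]mulr1 nrm_rs ler_piMr ?nrm1_le1. Qed.

Lemma nrm_star a : nrm (star a) = nrm a.
Proof.
have le_star b : nrm b <= nrm (star b).
  have := unormM (star b) b; rewrite unorm_starM.
  by have := nrm_ge0 b; have := nrm_ge0 (star b); nra.
by apply/eqP; rewrite eq_le le_star andbT -{2}(starK a) le_star.
Qed.

Lemma nrm_sa2 a : star a = a -> nrm (a * a) = nrm a ^+ 2.
Proof. by move=> sa; rewrite -unorm_starM sa. Qed.

Lemma nrm_eq0_le a (c : R) : (forall e, 0 < e -> nrm a <= c * e) -> a = 0.
Proof.
move=> ac; apply: nrm_le0; apply/ler_addgt0Pr => e e0; rewrite add0r.
have [c0|c0] := leP c 0; first by have := ac _ e0; nra.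
by have := ac (e / c) (divr_gt0 e0 c0); rewrite mulrC divfK // gt_eqF.
Qed.

(** Membership of [b] in the bicommutant of [a], the substitute for [b] being a function of [a]. *)
Definition commutant a b := forall c, GRing.comm a c -> GRing.comm b c.

Lemma ncvg_comm u l b :
  (forall n, GRing.comm (u n) b) -> ncvg nrm u l -> GRing.comm l b.
Proof.
move=> ub ul; apply/subr0_eq/(@nrm_eq0_le _ (2 * nrm b)) => e /ul[n0 h].
have {h} := h _ (leqnn n0); set v := u n0 => vl.
have -> : l * b - b * l = b * (v - l) - (v - l) * b.
  by have vb := ub n0; rewrite mulrBl mulrBr /v -vb; ncring.
have := unormD (b * (v - l)) (- ((v - l) * b)); rewrite nrmN.
have := unormM b (v - l); have := unormM (v - l) b; have := nrm_ge0 b; nra.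
Qed.

Lemma ncvg_sa u l :
  (forall n, star (u n) = u n) -> ncvg nrm u l -> star l = l.
Proof.
move=> us ul; apply/subr0_eq/(@nrm_eq0_le _ 2) => e /ul[n0 h].
have {h} := h _ (leqnn n0) => vl.
have -> : star l - l = (u n0 - l) - star (u n0 - l).
  by rewrite starB us; ncring.
by have := unormD (u n0 - l) (- star (u n0 - l)); rewrite nrmN nrm_star; lra.
Qed.

(** With [s = 1 - w] the equation [s * s = 1 - a] becomes [w + w = a + w * w], which
    [half_square_fixpoint] solves. The bound on [1 - s] is what later makes [s] positive. *)
Lemma sqrt_one_sub a : star a = a -> nrm a <= 1 ->
  exists s, [/\ star s = s, s * s = 1 - a, nrm (1 - s) <= 1 & commutant a s].
Proof.
move=> sa a1.
have [||||||||||w [sw w1 cw] eqw] := @half_square_fixpoint R B nrm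
    (fun a => rs 2^-1 * a) *%R a
    (fun w => [/\ star w = w, nrm w <= 1 & commutant a w])
    (@unormD R B) nrmN nrm0 (@unorm_eq0 R B) (@ucomplete R B).
- by move=> b; rewrite -mulrDl -rsD -[X in X + X]mul1r -splitr rs1 mul1r.
- by move=> b c; rewrite mulrBr.
- by move=> b; rewrite nrm_rs ger0_norm 1?mulrC // invr_ge0.
- by move=> b c d; rewrite mulrBl.
- by move=> b c d; rewrite mulrBr.
- exact: unormM.
- exact: a1.
- by split=> [||c _]; [exact: star0 | rewrite nrm0 | exact: comml_0].
- move=> b [sb b1 cb]; split.
    by rewrite starM starD starM sb sa star_rs rsC.
    rewrite nrm_rs ger0_norm ?invr_ge0 //; have := unormD a (b * b).
    by have := unormM b b; have := nrm_ge0 b; nra.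
  move=> c ac; have bc := cb _ ac.
  by apply: comml_mul => //; apply: comml_add => //; apply: comml_mul.
- move=> u l uD ul; split; first by apply: ncvg_sa ul => n; case: (uD n).
    by apply: (ncvg_le (@unormD R B) nrmN _ ul) => n; case: (uD n).
  by move=> c ac; apply: ncvg_comm ul => n; case: (uD n) => _ _; apply.
exists (1 - w); split.
- by rewrite starB star1 sw.
- have -> : (1 - w) * (1 - w) = 1 - (w + w) + w * w by ncring.
  by rewrite eqw; ncring.
- by rewrite opprB addrC subrK.
- by move=> c /cw wc; apply: comml_sub.
Qed.

(* [h] is the real part of [h + i k], whose norm is given by the C*-identity. *)
Lemma nrm_sqr_le_add h k : star h = h -> star k = k -> GRing.comm h k ->
  nrm (h * h) <= nrm (h * h + k * k).
Proof.
move=> sh sk hk; pose u := h + im * k.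
have su : star u = h - im * k.
  by rewrite starD starM sh sk star_im mulrN -imC.
have uu : star u * u = h * h + k * k.
  have -> : star u * u =
      h * h + h * (im * k) - im * (k * h) - (im * k) * (im * k).
    by rewrite su /u; ncring.
  have -> : h * (im * k) = im * (k * h) by rewrite mulrA -imC -mulrA hk.
  have -> : im * k * (im * k) = - (k * k).
    by rewrite mulrA -(mulrA im) -imC mulrA im2 -mulrA mulN1r.
  ncring.
have hu : h + h = u + star u by rewrite su /u; ncring.
have : nrm h <= nrm u.
  have -> : nrm h = nrm (h + h) / 2.
    by rewrite -[h in h + h]mul1r -mulrDl -rs1 -rsD nrm_rs ger0_norm //; lra.
  by rewrite hu; have := unormD u (star u); rewrite nrm_star; lra.
rewrite -uu unorm_starM nrm_sa2 // => hu'.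
by rewrite ler_sqr ?nnegrE ?nrm_ge0.
Qed.

(* Kelley and Vaught's form of positivity, for which sums are immediate. *)
Definition pos a := star a = a /\ exists t, nrm (rs t - a) <= t.

Lemma pos_sa a : pos a -> star a = a.
Proof. by case. Qed.

(** With [t] from the definition of [pos], [a = t (1 - (t - a) / t)], and [sqrt_one_sub] applies to
    [(t - a) / t]; [t = 0] forces [a = 0]. *)
Lemma pos_sqrt a : pos a ->
  exists s, [/\ pos s, s * s = a & commutant a s].
Proof.
move=> [sa [t ta]]; have t0 : 0 <= t := le_trans (nrm_ge0 _) ta.
have [t_eq0|t_neq0] := eqVneq t 0.
  move: ta; rewrite t_eq0 rs0 sub0r nrmN => /nrm_le0 ->.
  exists 0; split=> [||c _]; [split | by rewrite mulr0 | exact: comml_0].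
    exact: star0.
  by exists 0; rewrite rs0 subr0 nrm0.
have [ | |s [ss s2 s1 sc]] := @sqrt_one_sub (rs t^-1 * (rs t - a)).
- by rewrite starM starB !star_rs sa rsC.
- by rewrite nrm_rs ger0_norm ?invr_ge0 // mulrC ler_pdivrMr ?mul1r //
  lt_def t_neq0.
exists (rs (Num.sqrt t) * s); split.
- split; first by rewrite starM star_rs ss rsC.
  exists (Num.sqrt t); rewrite -[X in X - _]mulr1 -mulrBr nrm_rs.
  by rewrite ger0_norm ?sqrtr_ge0 // ler_piMr ?sqrtr_ge0.
- rewrite mulrA -(mulrA _ s) -rsC mulrA -rsM -expr2 sqr_sqrtr // -mulrA s2.
  rewrite mulrBr mulrA -rsM divff // mulr1 rs1 mul1r; ncring.
- move=> c ac; have sc' : GRing.comm s c.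
    by apply: sc; apply: comml_mul => //; apply: comml_sub.
  exact: comml_mul.
Qed.

(** After scaling to [k = h / r], the element [1 - k * k] is the square of some [s] commuting with
    [k], and [nrm_sqr_le_add] bounds [s * s] by [s * s + k * k = 1]. *)
Lemma nrm_sqr_dist h (r : R) : 0 < r -> star h = h -> nrm h <= r ->
  nrm (rs (r ^+ 2) - h * h) <= r ^+ 2.
Proof.
move=> r0 sh hr; pose k := rs r^-1 * h.
have sk : star k = k by rewrite starM star_rs sh -rsC.
have k1 : nrm k <= 1.
  by rewrite nrm_rs gtr0_norm ?invr_gt0 // mulrC ler_pdivrMr ?mul1r.
have [||s [ss s2 _ sc]] := @sqrt_one_sub (k * k).
- by rewrite starM sk.
- by rewrite nrm_sa2 // expr_le1 ?nrm_ge0.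
have -> : rs (r ^+ 2) - h * h = rs (r ^+ 2) * (s * s).
  have -> : h = rs r * k by rewrite mulrA -rsM divff ?gt_eqF // rs1 mul1r.
  rewrite s2 mulrBr mulr1 -[rs r * k * _]mulrA (mulrA k) -(rsC r k).
  by rewrite -(mulrA (rs r) k) mulrA -rsM.
have r2 : 0 <= r ^+ 2 by rewrite exprn_ge0 // ltW.
rewrite nrm_rs ger0_norm // ler_piMr //.
apply: le_trans (nrm1_le1); rewrite -[1](subrK (k * k)) -s2.
by apply: nrm_sqr_le_add => //; apply: sc; apply: comml_mul.
Qed.

(** Replaces the unknown witness in [pos a] by any bound of the norm: [a] is the square of a
    self-adjoint element, so [nrm_sqr_dist] applies with radius [Num.sqrt t]. *)
Lemma pos_dist a t : pos a -> nrm a <= t -> nrm (rs t - a) <= t.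
Proof.
move=> /pos_sqrt[s [/pos_sa ss <- _]] st; have := le_trans (nrm_ge0 _) st.
rewrite le_eqVlt => /orP[/eqP t0|t0].
  by move: st; rewrite -t0 => /nrm_le0 ->; rewrite rs0 subr0 nrm0.
rewrite -[t](sqr_sqrtr (ltW t0)); apply: nrm_sqr_dist; rewrite ?sqrtr_gt0 //.
by rewrite -[nrm s]ger0_norm ?nrm_ge0 // -sqrtr_sqr ler_wsqrtr // -nrm_sa2.
Qed.

Lemma pos_sqr h : star h = h -> pos (h * h).
Proof.
move=> sh; split; first by rewrite starM sh.
exists ((nrm h + 1) ^+ 2); apply: nrm_sqr_dist => //; last by rewrite lerDl.
by rewrite ltr_wpDl ?nrm_ge0.
Qed.

Lemma posD a b : pos a -> pos b -> pos (a + b).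
Proof.
move=> [sa [s a_s]] [sb [t bt]]; split; first by rewrite starD sa sb.
exists (s + t); rewrite rsD opprD addrACA.
exact: le_trans (unormD _ _) (lerD _ _).
Qed.

Lemma pos_rs t : 0 <= t -> pos (rs t).
Proof.
by move=> t0; split; [exact: star_rs | exists t; rewrite subrr nrm0].
Qed.

Lemma pos0 : pos 0. Proof. by rewrite -rs0; apply: pos_rs. Qed.

Lemma pos1 : pos 1. Proof. by rewrite -rs1; apply: pos_rs. Qed.

Lemma pos_mul a b : pos a -> pos b -> GRing.comm a b -> pos (a * b).
Proof.
move=> /pos_sqrt[h [/pos_sa sh <- hc]] /pos_sqrt[k [/pos_sa sk <- kc]] hk.
have {}hk : GRing.comm h k by exact/hc/commr_sym/kc/commr_sym.
have -> : h * h * (k * k) = (h * k) * (h * k).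
  by rewrite -!mulrA (mulrA k h) -hk !mulrA.
by apply: pos_sqr; rewrite starM sh sk hk.
Qed.

Lemma posZ t a : 0 <= t -> pos a -> pos (rs t * a).
Proof. by move=> /pos_rs t0 a0; apply: pos_mul. Qed.

(** [a] and [rs t - a] are squares of commuting self-adjoint elements with sum [rs t], the situation
    of [nrm_sqr_le_add]. *)
Lemma nrm_le_pos t a : 0 <= t -> pos a -> pos (rs t - a) -> nrm a <= t.
Proof.
move=> t0 /pos_sqrt[h [/pos_sa sh ha hc]] /pos_sqrt[k [/pos_sa sk kt kc]].
have hk : GRing.comm h k by apply/hc/commr_sym/kc/comml_sub.
have := nrm_sqr_le_add sh sk hk; rewrite ha kt addrC subrK => /le_trans; apply.
by rewrite -[leRHS]ger0_norm // nrm_rs1.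
Qed.

Lemma pos_rsB t a : star a = a -> nrm a <= t -> pos (rs t - a).
Proof.
move=> sa a_t; split; first by rewrite starB sa star_rs.
by exists t; rewrite opprB addrC subrK.
Qed.

Lemma pos_mono a b : pos a -> pos (b - a) -> nrm a <= nrm b.
Proof.
move=> a0 ab; apply: nrm_le_pos => //; first exact: nrm_ge0.
have sb : star b = b by rewrite -(subrK a b) starD !pos_sa.
have -> : rs (nrm b) - a = (rs (nrm b) - b) + (b - a) by ncring.
exact: posD (pos_rsB sb (lexx _)) ab.
Qed.

Lemma pos_anti a : pos a -> pos (- a) -> a = 0.
Proof.
by move=> a0 aN; apply: nrm_le0; apply: nrm_le_pos => //; rewrite rs0 sub0r.
Qed.

(** The witnesses of [pos (u n)] need not be bounded in [n]; [pos_dist] exchanges them for norm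
    bounds, which survive the limit. *)
Lemma ncvg_pos u l : (forall n, pos (u n)) -> ncvg nrm u l -> pos l.
Proof.
move=> u0 ul; split; first by apply: ncvg_sa ul => n; apply: pos_sa.
exists (nrm l); apply/ler_addgt0Pr => e e0; have e30 : 0 < e / 3 by lra.
have [n0 /(_ _ (leqnn _)) h] := ul _ e30; set v := u n0 in h.
have vl : nrm v <= nrm l + e / 3.
  by have := unormD (v - l) l; rewrite subrK; lra.
have := pos_dist (u0 n0) vl; rewrite -/v rsD => vd.
have -> : rs (nrm l) - l = (rs (nrm l) + rs (e / 3) - v) + (v - l) - rs (e / 3).
  by ncring.
have := unormD (rs (nrm l) + rs (e / 3) - v + (v - l)) (- rs (e / 3)).
have := unormD (rs (nrm l) + rs (e / 3) - v) (v - l).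
by have := nrm_rs1 (e / 3); rewrite nrmN gtr0_norm //; lra.
Qed.

(** If [x] and [y] are the real and imaginary parts of [c], the element is [2 (x ^+ 2 + y ^+ 2)]. *)
Lemma pos_starM_add c : pos (star c * c + c * star c).
Proof.
have -> : star c * c + c * star c = rs 2^-1 *
    ((c + star c) * (c + star c) + (im * (c - star c)) * (im * (c - star c))).
  have -> : im * (c - star c) * (im * (c - star c)) =
            - ((c - star c) * (c - star c)).
    by rewrite mulrA -(mulrA im) -imC mulrA im2 -mulrA mulN1r.
  have -> : (c + star c) * (c + star c) - (c - star c) * (c - star c) =
            (1 + 1) * (star c * c + c * star c) by ncring.
  have half2 : rs 2^-1 * (1 + 1) = 1.
    by rewrite -{1 2}rs1 -rsD -rsM -[RHS]rs1; congr rs; lra.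
  by rewrite mulrA half2 mul1r.
apply: posZ; first by rewrite invr_ge0.
apply: posD; apply: pos_sqr; first by rewrite starD starK addrC.
by rewrite starM starB starK star_im mulrN -imC -mulrN opprB.
Qed.

(* Apply [pos_starM_add] to [c * e]: both [star (c * e) * (c * e)] and
   [(c * e) * star (c * e)] are negatives of squares. *)
Lemma starM_neg_sqr c e : star e = e -> star c * c = - (e * e) -> c = 0.
Proof.
move=> se cc; have := pos_starM_add (c * e).
pose p := c * star c.
have sp : star p = p by rewrite starM starK.
have -> : star (c * e) * (c * e) = - (e * e * (e * e)).
  have -> : star (c * e) * (c * e) = e * (star c * c) * e.
    by rewrite starM se; ncring.
  by rewrite cc; ncring.
have -> : c * e * star (c * e) = - (p * p).
  have -> : c * e * star (c * e) = - (c * - (e * e) * star c).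
    by rewrite starM se; ncring.
  by rewrite -cc /p; ncring.
move=> neg; have {}neg : pos (- (p * p)).
  have -> : - (p * p) = e * e * (e * e) + (- (e * e * (e * e)) - p * p) by
    ncring.
  by apply: posD => //; apply: pos_sqr; rewrite starM se.
have pp0 := pos_anti (pos_sqr sp) neg.
have : p = 0.
  by apply: nrm_le0; have := nrm_sa2 sp; rewrite pp0 nrm0; have := nrm_ge0 p;
    nra.
move=> p0; apply: nrm_le0; have := unorm_starM (star c); rewrite starK -/p p0.
by rewrite nrm0 nrm_star; have := nrm_ge0 c; nra.
Qed.

(* With [r] the absolute value of [a = star b * b] and [g = r - a], i.e. twice
   the negative part of [a], the element [c = b * g] satisfies
   [star c * c = - g ^+ 3 / 2]. *)
Lemma pos_starM b : pos (star b * b).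
Proof.
pose a := star b * b; have sa : star a = a by rewrite starM starK.
have [r [r0 r2 rc]] := pos_sqrt (pos_sqr sa); have sr := pos_sa r0.
have [h [/pos_sa sh h2 hc]] := pos_sqrt r0.
have ra : GRing.comm r a by apply: rc; rewrite /GRing.comm mulrA.
have ha : GRing.comm h a by apply: hc.
have hr : GRing.comm h r by apply: hc.
rewrite -/a; pose g := r - a; suff g0 : g = 0 by rewrite -(subr0_eq g0).
have sg : star g = g by rewrite starB sr sa.
have hg : GRing.comm h g by apply: commrB.
have rg2 : r * g + r * g = g * g.
  have : (r + a) * g = 0.
    have -> : (r + a) * g = r * r + (a * r - r * a) - a * a by rewrite /g;
      ncring.
    by rewrite r2 ra; ncring.
  by move=> rag; apply/subr0_eq; rewrite -rag /g; ncring.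
have sqr0 e : star e = e -> e * e = 0 -> e = 0.
  move=> se e2; apply: nrm_le0; have := nrm_sa2 se; rewrite e2 nrm0.
  by have := nrm_ge0 e; nra.
have she : star (h * g) = h * g by rewrite starM sh sg hg.
have gag : star (b * g) * (b * g) = - (h * g * (h * g)).
  have -> : star (b * g) * (b * g) = g * (r * g) - g * (g * g).
    by rewrite starM sg -mulrA (mulrA (star b)) -/a /g; ncring.
  by rewrite -rg2 {1}hg -(mulrA g) (mulrA h h) h2; ncring.
have := starM_neg_sqr she gag => bg0.
apply: (sqr0 g) => //; rewrite -rg2 -h2 -mulrA (sqr0 _ she) ?mulr0 ?addr0 //.
by rewrite -[LHS]opprK -gag bg0 mulr0 oppr0.
Qed.

Lemma pos_conj a b : pos a -> pos (star b * a * b).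
Proof.
move=> /pos_sqrt[h [/pos_sa sh <- _]].
have -> : star b * (h * h) * b = star (h * b) * (h * b).
  by rewrite starM sh; ncring.
exact: pos_starM.
Qed.

Lemma commr_rs t a : GRing.comm a (rs t).
Proof. exact/commr_sym/comm_rs. Qed.

#[local] Hint Resolve commr_rs commr1 : core.

(** * Elements above the identity: inverses and n-th roots *)

Lemma ge1_pos X : pos (X - 1) -> pos X.
Proof. by move=> X1; rewrite -(subrK 1 X); apply: posD X1 (pos1). Qed.

(** The Neumann series as a fixed point of [Y = t^-1 (1 + (t - X) Y)]. Since
    [t - X = (t - 1) - (X - 1)] and [t - 1] is the norm of [X - 1], [pos_dist] gives the contraction
    ratio [(t - 1) / t]. *)
Lemma ge1_inverse X : pos (X - 1) ->
  exists Y, [/\ X * Y = 1, Y * X = 1, pos Y, pos (1 - Y) & commutant X Y].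
Proof.
move=> X1; pose t := 1 + nrm (X - 1).
have t1 : 1 <= t by rewrite lerDl nrm_ge0.
have t0 : 0 < t by lra.
have tV0 : 0 <= t^-1 by rewrite invr_ge0; lra.
have tX : nrm (rs t - X) <= t - 1.
  have -> : rs t - X = rs (t - 1) - (X - 1).
    by rewrite rsB rs1; ncring.
  by apply: pos_dist => //; rewrite /t; lra.
pose F Y := rs t^-1 * (1 + (rs t - X) * Y).
have [] := @contraction_fixpoint R B nrm (@unormD R B) nrmN nrm0
  (@ucomplete R B) F (commutant X) ((t - 1) / t) 0 (@unorm_eq0 R B).
- by rewrite divr_ge0 //; lra.
- by rewrite ltr_pdivrMr //; lra.
- by move=> c _; apply: comml_0.
- move=> Y cY c Xc; apply: comml_mul => //; apply: comml_add => //.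
  by apply: comml_mul; [apply: comml_sub | apply: cY].
- move=> u l uD ul c Xc; apply: ncvg_comm ul => n; exact: uD.
- move=> a b _ _; have -> : F a - F b = rs t^-1 * ((rs t - X) * (a - b)).
    by rewrite /F; ncring.
  rewrite nrm_rs ger0_norm // mulrAC mulrC ler_wpM2r //.
  apply: le_trans (unormM _ _) _.
  by rewrite ler_wpM2r ?nrm_ge0.
move=> Y cY eY; have XY : X * Y = 1.
  have /eqP : rs t * Y = 1 + (rs t - X) * Y.
    by rewrite -{1}eY mulrA -rsM divff ?gt_eqF // rs1 mul1r.
  by rewrite mulrBl addrCA -subr_eq0 opprD addNKr oppr_eq0 subr_eq0 => /eqP.
have sX : star X = X := pos_sa (ge1_pos X1).
have YX : Y * X = 1 by rewrite cY.
have sY : star Y = Y.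
  have YsX : star Y * X = 1 by rewrite -{1}sX -starM XY star1.
  by rewrite -[LHS]mulr1 -XY mulrA YsX mul1r.
have Y0 : pos Y.
  by have := pos_conj Y (ge1_pos X1); rewrite sY YX mul1r.
exists Y; split=> //.
have -> : 1 - Y = (X - 1) * Y by rewrite mulrBl XY mul1r.
by apply: pos_mul => //; apply: comml_sub; rewrite // /GRing.comm XY YX.
Qed.

Lemma ge1_nrmV X Y : pos (X - 1) -> X * Y = 1 -> nrm Y <= 1.
Proof.
move=> /ge1_inverse[Z [_ ZX Z0 Z1 _]] XY.
have <- : Z = Y by rewrite -[Y]mul1r -ZX -mulrA XY mulr1.
by apply: nrm_le_pos => //; rewrite rs1.
Qed.

Lemma pos_mulB a b c d : pos a -> pos (b - a) -> pos c -> pos (d - c) ->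
  GRing.comm a c -> GRing.comm a d -> GRing.comm b c -> GRing.comm b d ->
  pos (b * d - a * c).
Proof.
move=> a0 ab c0 cd ac ad bc bd.
have -> : b * d - a * c = (b - a) * d + a * (d - c) by ncring.
have d0 : pos d by rewrite -(subrK c d); apply: posD.
apply: posD; apply: pos_mul => //; first exact: comml_sub.
exact: commrB.
Qed.

Lemma posX a n : pos a -> pos (a ^+ n).
Proof.
move=> a0; elim: n => [|n IHn]; first by rewrite expr0; apply: pos1.
by rewrite exprS; apply: pos_mul => //; apply: commrX.
Qed.

Lemma pos_expB a b n : pos a -> pos (b - a) -> GRing.comm a b ->
  pos (b ^+ n - a ^+ n).
Proof.
move=> a0 ab ca; elim: n => [|n IHn].
  by rewrite !expr0 subrr; apply: pos0.
rewrite !exprS; apply: pos_mulB => //; first exact: posX.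
- exact: commrX.
- exact: commrX.
- by apply: commrX; apply: commr_sym.
- exact: commrX.
Qed.

Lemma ge1X X n : pos (X - 1) -> pos (X ^+ n - 1).
Proof.
by move=> X1; have := @pos_expB 1 X n (pos1) X1 (comml_1 X); rewrite expr1n.
Qed.

Lemma rsX t n : rs (t ^+ n) = rs t ^+ n.
Proof. by elim: n => [|n IHn]; rewrite ?expr0 ?rs1 // !exprS rsM IHn. Qed.

Lemma pos_sum (I : Type) (r : seq I) (F : I -> B) :
  (forall i, pos (F i)) -> pos (\sum_(i <- r) F i).
Proof.
by move=> F0; elim/big_ind: _ => //; [exact: pos0 | exact: posD].
Qed.

Lemma ge1_mul X Y : pos (X - 1) -> pos (Y - 1) -> GRing.comm X Y ->
  pos (X * Y - 1).
Proof.
move=> X1 Y1 XY; rewrite -[X in _ - X](mulr1 1).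
by apply: pos_mulB => //; rewrite ?/GRing.comm ?mulr1 ?mul1r //; exact: pos1.
Qed.

Lemma rs_nat n : rs n%:R = n%:R.
Proof.
by elim: n => [|n IHn]; rewrite ?mulr0n ?rs0 // !mulrSr rsD IHn rs1.
Qed.

(* [S |-> S + (X - S ^+ n) / (n c ^+ n.-1)] is a contraction of the interval
   [1 <= S <= c] when [X <= c ^+ n]. *)
Lemma nth_root_exists X n : (0 < n)%N -> pos (X - 1) ->
  exists S, [/\ pos (S - 1), S ^+ n = X & commutant X S].
Proof.
move=> n0 X1; pose c : R := 1 + nrm X.
have c1 : 1 <= c by rewrite lerDl nrm_ge0.
have c0 : 0 <= c by lra.
have cX1 m : 1 <= c ^+ m by rewrite exprn_ege1.
have Xc : pos (rs (c ^+ n) - X).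
  apply: pos_rsB; first exact/pos_sa/ge1_pos.
  have : c <= c ^+ n by rewrite -[leLHS]expr1 ler_weXn2l.
  by rewrite /c; lra.
pose q := c ^+ n.-1; pose kap := n%:R * q.
have q1 : 1 <= q := cX1 _.
have n1 : 1 <= n%:R :> R by rewrite ler1n.
have kap0 : 0 < kap by rewrite /kap; nra.
have kapV0 : 0 <= kap^-1 by rewrite invr_ge0 ltW.
pose F S := S + rs kap^-1 * (X - S ^+ n).
pose D S := [/\ pos (S - 1), pos (rs c - S) & commutant X S].
have Dcomm S S' : D S -> D S' -> GRing.comm S S'.
  by move=> [_ _ cS] [_ _ cS']; apply/cS/commr_sym/cS'.
have rc1 : pos (rs c - 1) by rewrite -rs1 -rsB; apply: pos_rs; lra.
(* Here [K = 1 - L / kap] with [L] the divided difference of the n-th power. On [D] one has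
   [n <= L <= n q = kap], so [0 <= K <= 1 - q^-1]: the upper bound gives contraction, the lower one
   monotonicity. *)
have FB S S' : D S -> D S' ->
    exists K, [/\ F S - F S' = (S - S') * K, pos K, pos (rs (1 - q^-1) - K)
               & commutant X K].
  move=> DS DS'; have SS' := Dcomm _ _ DS DS'.
  have [S1 Sc cS] := DS; have [S1' Sc' cS'] := DS'.
  pose L := \sum_(i < n) S ^+ (n.-1 - i) * S' ^+ i.
  have SL : S ^+ n - S' ^+ n = (S - S') * L by rewrite subrXX_comm.
  have XS (i j : nat) : GRing.comm (S ^+ i) (S' ^+ j).
    by apply: commrX; apply/commr_sym/commrX/commr_sym.
  have L1 : pos (L - n%:R).
    have -> : n%:R = \sum_(i < n) 1 :> B by rewrite sumr_const card_ord.
    rewrite -sumrB.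
    by apply: pos_sum => i; apply: ge1_mul => //; apply: ge1X.
  have L2 : pos (rs kap - L).
    have -> : rs kap = \sum_(i < n) rs q.
      by rewrite sumr_const card_ord /kap rsM rs_nat mulr_natl.
    rewrite -sumrB; apply: pos_sum => i.
    have -> : q = c ^+ (n.-1 - i) * c ^+ i.
      by rewrite /q -exprD subnK // -ltnS prednK.
    rewrite rsM !rsX; apply: pos_mulB.
    - exact/posX/ge1_pos.
    - by apply: pos_expB => //; exact: ge1_pos.
    - exact/posX/ge1_pos.
    - by apply: pos_expB => //; exact: ge1_pos.
    - exact: XS.
    - by rewrite -rsX; exact/commr_sym/comm_rs.
    - by rewrite -rsX; exact: comm_rs.
    - by rewrite -rsX; exact: comm_rs.
  exists (1 - rs kap^-1 * L); split.
  - rewrite mulrBr mulr1 (mulrA (S - S')) -rsC -mulrA -SL /F; ncring.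
  - have -> : 1 - rs kap^-1 * L = rs kap^-1 * (rs kap - L).
      by rewrite mulrBr -rsM mulVf ?gt_eqF // rs1.
    exact: posZ.
  - have -> : rs (1 - q^-1) - (1 - rs kap^-1 * L) = rs kap^-1 * (L - n%:R).
      have kn : kap^-1 * n%:R = q^-1.
        by rewrite /kap invfM mulrAC mulVf ?mul1r // pnatr_eq0 -lt0n.
      by rewrite mulrBr -rs_nat -rsM kn rsB rs1; ncring.
    exact: posZ.
  - move=> d Xd; apply: comml_sub => //; apply: comml_mul => //.
    rewrite /L; elim/big_ind: _ => [|a b|i _];
      [exact: comml_0 | exact: comml_add|].
    by apply: comml_mul; apply/commr_sym/commrX/commr_sym;
      [exact: cS | exact: cS'].
have D1 : D 1 by split=> [||d _] //; rewrite subrr; apply: pos0.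
have Dc : D (rs c) by split=> [||d _] //; rewrite subrr; apply: pos0.
(* By monotonicity it suffices that [F 1 >= 1] and [F c <= c], which are [X >= 1] and
   [X <= c ^+ n]. *)
have DF S : D S -> D (F S).
  move=> DS; have [S1 Sc cS] := DS; split.
  - have [K [eK K0 _ cK]] := FB _ _ DS D1.
    have -> : F S - 1 = (S - 1) * K + rs kap^-1 * (X - 1).
      by rewrite -eK /F expr1n; ncring.
    apply: posD; last exact: posZ.
    by apply: pos_mul => //; apply/commr_sym/cK/commrB => //;
      exact/commr_sym/cS.
  - have [K [eK K0 _ cK]] := FB _ _ Dc DS.
    have -> : rs c - F S = (rs c - S) * K + rs kap^-1 * (rs (c ^+ n) - X).
      by rewrite -eK /F -rsX; ncring.
    apply: posD; last exact: posZ.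
    apply: pos_mul => //; apply/commr_sym/cK/commrB; last exact/commr_sym/cS.
    exact/commr_sym/comm_rs.
  - move=> d Xd; apply: comml_add; first exact: cS.
    apply: comml_mul => //; apply: comml_sub => //.
    by apply/commr_sym/commrX/commr_sym/cS.
have qV : 0 < q^-1 <= 1 by rewrite invr_gt0 invf_le1; lra.
have [] := @contraction_fixpoint R B nrm (@unormD R B) nrmN nrm0
  (@ucomplete R B) F D (1 - q^-1) 1 (@unorm_eq0 R B).
- lra.
- lra.
- exact: D1.
- exact: DF.
- move=> u l uD ul; have shift e : ncvg nrm (fun n => u n + e) (l + e).
    move=> eps /ul[m h]; exists m => i /h.
    by rewrite opprD addrACA subrr addr0.
  have opp : ncvg nrm (fun n => - u n) (- l).
    by move=> eps /ul[m h]; exists m => i /h; rewrite -opprD nrmN.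
  have oshift e : ncvg nrm (fun n => e - u n) (e - l).
    move=> eps /opp[m h]; exists m => i /h.
    by rewrite (addrC e) (addrC e) opprD addrACA subrr addr0.
  split.
  + by apply: ncvg_pos (shift (- 1)) => i; case: (uD i).
  + by apply: ncvg_pos (oshift (rs c)) => i; case: (uD i).
  + by move=> d Xd; apply: ncvg_comm ul => i; case: (uD i) => _ _; apply.
- move=> S S' DS DS'; have [K [-> K0 K1 _]] := FB _ _ DS DS'.
  apply: le_trans (unormM _ _) _; rewrite mulrC ler_wpM2r ?nrm_ge0 //.
  by apply: nrm_le_pos => //; lra.
move=> S [S1 Sc cS] FS; exists S; split=> //.
apply/esym/subr0_eq;
  have /(congr1 (fun a => rs kap * a)) : rs kap^-1 * (X - S ^+ n) = 0.
  by apply: (addrI S); rewrite addr0.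
by rewrite mulrA -rsM divff ?gt_eqF // rs1 mul1r mulr0.
Qed.

(** [S ^+ n - S' ^+ n = (S - S') L], and [L] is invertible: its term [S ^+ n.-1] is at least 1 and
    the other terms are positive. *)
Lemma ge1_root_unique S S' n : (0 < n)%N -> pos (S - 1) -> pos S' ->
  GRing.comm S S' -> S ^+ n = S' ^+ n -> S' = S.
Proof.
move=> n0 S1 S0' SS' eSn.
pose L := \sum_(i < n) S ^+ (n.-1 - i) * S' ^+ i.
have SL : (S - S') * L = 0 by rewrite -subrXX_comm // eSn subrr.
have /ge1_inverse[Y [LY _ _ _ _]] : pos (L - 1).
  rewrite /L; case: n n0 {eSn SL L} => // n _.
  rewrite big_ord_recl /= subn0 expr0 mulr1 addrAC.
  apply: posD; first exact: ge1X.
  apply: pos_sum => i; apply: pos_mul; [exact/posX/ge1_pos | exact: posX |].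
  by apply: commrX; apply/commr_sym/commrX/commr_sym.
apply/esym/subr0_eq; rewrite -[LHS]mulr1 -LY mulrA SL mul0r //.
Qed.

(** * Projections and roots in their corners *)

Lemma proj_nrm_le1 M : star M = M -> M * M = M -> nrm M <= 1.
Proof.
by move=> sM MM; have := nrm_sa2 sM; rewrite MM; have := nrm_ge0 M; nra.
Qed.

Lemma idem_expr M n : M * M = M -> (0 < n)%N -> M ^+ n = M.
Proof.
move=> MM; case: n => // n _; elim: n => [|n IHn]; first by rewrite expr1.
by rewrite exprS IHn.
Qed.

Lemma orth_expr a c n : c * c = c -> a * c = 0 -> c * a = 0 ->
  (a + c) ^+ n.+1 = a ^+ n.+1 + c.
Proof.
move=> cc ac ca; elim: n => [|n IHn]; first by rewrite !expr1.
have can : c * a ^+ n.+1 = 0 by rewrite exprS mulrA ca mul0r.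
rewrite exprS IHn (exprS a n.+1) mulrDl !mulrDr can cc ac add0r addr0 //.
Qed.

Lemma proj_pos M : star M = M -> M * M = M -> pos M.
Proof. by move=> sM MM; rewrite -MM -{1}sM; apply: pos_starM. Qed.

(** By the C*-identity [S ^+ n.+2 * a = 0] forces [S ^+ n.+1 * a = 0]. In [corner_root] this
    confines every positive root of [T] to the corner of [M]. *)
Lemma sa_expr_mul_eq0 S a n : star S = S -> S ^+ n.+1 * a = 0 -> S * a = 0.
Proof.
move=> sS; elim: n => [|n IHn]; first by rewrite expr1.
rewrite 2!exprS => SSa; apply: IHn; apply: nrm_le0.
have := unorm_starM (S ^+ n.+1 * a).
have -> : star (S ^+ n.+1 * a) * (S ^+ n.+1 * a) =
    star a * (star (S ^+ n) * (S * S * S ^+ n * a)).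
  by rewrite exprS !starM sS -!mulrA.
have -> : S * S * S ^+ n * a = 0 by rewrite -!mulrA in SSa *.
by rewrite !mulr0 nrm0; have := nrm_ge0 (S ^+ n.+1 * a); nra.
Qed.

(* On the range of [M] the operator [T] dominates the identity, so that
   [T + (1 - M) >= 1] has an n-th root [Y]; cut down by [M] it is the n-th root
   of [T]. The norm bound is Bernoulli's inequality. *)
Lemma corner_root T M n : star M = M -> M * M = M -> M * T = T -> T * M = T ->
    pos (T - M) -> (0 < n)%N ->
  exists Y, [/\ pos (Y - 1), GRing.comm Y M, pos (Y * M), (Y * M) ^+ n = T &
    (forall S, pos S -> S ^+ n = T -> S = Y * M) /\
    nrm (Y * M - M) <= nrm (T - M) / n%:R].
Proof.
move=> sM MM MT TM TM0 n0; pose X := T + (1 - M).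
have X1 : pos (X - 1) by rewrite (_ : _ - _ = T - M) // /X; ncring.
have XM : X * M = T by rewrite /X mulrDl mulrBl mul1r MM subrr addr0.
have MX : M * X = T by rewrite /X mulrDr mulrBr mulr1 MM subrr addr0.
have [Y [Y1 YX cY]] := nth_root_exists n0 X1.
have YM : GRing.comm Y M by apply: cY; rewrite /GRing.comm XM MX.
have M0 := proj_pos sM MM.
exists Y; split=> //.
- by apply: pos_mul => //; exact: ge1_pos.
- by rewrite exprMn_comm // YX idem_expr.
split.
  (* Uniqueness: [S] vanishes on [1 - M] because [T] does, so [S + (1 - M)] is a positive n-th root
     of [X] and must be [Y]. *)
  move=> S S0 ST; have sS := pos_sa S0.
  have S1M : S * (1 - M) = 0.
    apply: (@sa_expr_mul_eq0 _ _ n.-1) => //; rewrite prednK // ST.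
    by rewrite mulrBr mulr1 TM subrr.
  have SM : S * M = S.
    by apply/esym/subr0_eq; rewrite -S1M mulrBr mulr1.
  have MS : M * S = S by rewrite -{1}sM -{1}sS -starM SM.
  have SN1 : (1 - M) * S = 0 by rewrite mulrBl mul1r MS subrr.
  have NN : (1 - M) * (1 - M) = 1 - M.
    by rewrite mulrBr mulr1 mulrBl mul1r MM subrr subr0.
  pose S' := S + (1 - M).
  have S'X : S' ^+ n = X.
    by rewrite -(prednK n0) orth_expr // prednK // ST.
  have S'0 : pos S'.
    apply: posD => //; apply: proj_pos => //.
    by rewrite starB star1 sM.
  have YS' : GRing.comm Y S'.
    by apply: cY; rewrite -S'X; apply/commr_sym/commrX.
  have eS' : S' = Y by apply: (ge1_root_unique n0); rewrite ?S'X.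
  by rewrite -eS' mulrDl SM mulrBl mul1r MM subrr addr0.
have Bern : pos (rs (n%:R^-1) * (T - M) - (Y - 1)).
  have TMX : T - M = (Y - 1) * \sum_(i < n) Y ^+ i.
    by rewrite -subrX1 YX /X; ncring.
  have -> : Y - 1 = rs n%:R^-1 * ((Y - 1) * n%:R).
    rewrite -rs_nat mulrA -(mulrA _ (Y - 1)) -rsC mulrA -rsM mulVf ?rs1 ?mul1r
      //.
    by rewrite pnatr_eq0 -lt0n.
  rewrite TMX -mulrBr -mulrBr; apply: posZ; first by rewrite invr_ge0.
  have -> : n%:R = \sum_(i < n) 1 :> B by rewrite sumr_const card_ord.
  rewrite -sumrB; apply: pos_mul => //.
    by apply: pos_sum => i; apply: ge1X.
  by apply: commr_sum => i _; apply: commrB => //; apply/commrX/comml_sub.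
have nn : nrm (Y - 1) <= nrm (T - M) / n%:R.
  have := pos_mono Y1 Bern.
  by rewrite nrm_rs ger0_norm ?invr_ge0 // mulrC.
have -> : Y * M - M = (Y - 1) * M by rewrite mulrBl mul1r.
apply: le_trans (unormM _ _) _; apply: le_trans nn.
by rewrite ler_piMr ?nrm_ge0 // proj_nrm_le1.
Qed.

(** [1 - M2] annihilates [Y2 * M2], and [Y1] can be divided out at no cost because its inverse has
    norm at most 1. *)
Lemma proj_mul_nrm M1 M2 Y1 Y2 :
  star M1 = M1 -> M1 * M1 = M1 -> star M2 = M2 -> M2 * M2 = M2 ->
  pos (Y1 - 1) -> GRing.comm Y1 M1 -> GRing.comm Y2 M2 ->
  nrm ((1 - M2) * M1) <= nrm (Y1 * M1 - Y2 * M2).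
Proof.
move=> sM1 MM1 sM2 MM2 Y1_ge1 YM1 YM2; set d := nrm (Y1 * _ - _).
have [Z [YZ _ _ _ _]] := ge1_inverse Y1_ge1.
have -> : (1 - M2) * M1 = (1 - M2) * (Y1 * M1 - Y2 * M2) * Z.
  have N2 : (1 - M2) * M2 = 0 by rewrite mulrBl mul1r MM2 subrr.
  by rewrite mulrBr YM2 (mulrA _ M2) N2 mul0r subr0 YM1 -!mulrA YZ mulr1.
have N1 : nrm (1 - M2) <= 1.
  apply: proj_nrm_le1; first by rewrite starB star1 sM2.
  by rewrite mulrBr mulr1 mulrBl mul1r MM2 subrr subr0.
have Z1 := ge1_nrmV Y1_ge1 YZ.
have := unormM ((1 - M2) * (Y1 * M1 - Y2 * M2)) Z.
have := unormM (1 - M2) (Y1 * M1 - Y2 * M2); rewrite -/d.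
have := nrm_ge0 ((1 - M2) * (Y1 * M1 - Y2 * M2)); have := nrm_ge0 Z.
have := nrm_ge0 (Y1 * M1 - Y2 * M2); rewrite -/d; have := nrm_ge0 (1 - M2); nra.
Qed.

(* [(M1 - M2) ^+ 2] is block diagonal with respect to [M1]. *)
Lemma proj_dist_le M1 M2 Y1 Y2 :
  star M1 = M1 -> M1 * M1 = M1 -> star M2 = M2 -> M2 * M2 = M2 ->
  pos (Y1 - 1) -> GRing.comm Y1 M1 -> pos (Y2 - 1) -> GRing.comm Y2 M2 ->
  nrm (M1 - M2) <= nrm (Y1 * M1 - Y2 * M2).
Proof.
move=> sM1 MM1 sM2 MM2 Y1_ge1 YM1 Y2_ge1 YM2; set d := nrm (Y1 * _ - _).
have sN M : star M = M -> star (1 - M) = 1 - M by rewrite starB star1 => ->.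
have NN M : M * M = M -> (1 - M) * (1 - M) = 1 - M.
  by move=> MM; rewrite mulrBr mulr1 mulrBl mul1r MM subrr subr0.
have d0 : 0 <= d := nrm_ge0 _.
pose u := (1 - M2) * M1; pose v := M2 * (1 - M1).
have ud : nrm u <= d by exact: proj_mul_nrm.
have vd : nrm v <= d.
  have -> : v = star ((1 - M1) * M2) by rewrite starM sM2 sN.
  by rewrite nrm_star /d nrm_distC; exact: proj_mul_nrm.
have sq : (M1 - M2) * (M1 - M2) = star u * u + star v * v.
  rewrite !starM sM1 sM2 !sN // /u /v.
  have -> : M1 * (1 - M2) * ((1 - M2) * M1) = M1 * ((1 - M2) * (1 - M2)) * M1.
    by ncring.
  have -> : (1 - M1) * M2 * (M2 * (1 - M1)) = (1 - M1) * (M2 * M2) * (1 - M1).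
    by ncring.
  rewrite (NN _ MM2) MM2; have -> : M1 * (1 - M2) * M1 = M1 * M1 - M1 * M2 * M1.
    by ncring.
  have -> : (M1 - M2) * (M1 - M2) = M1 * M1 + M2 * M2 - M1 * M2 - M2 * M1.
    by ncring.
  rewrite MM2; ncring.
(* Compressing [star w * w <= d ^+ 2] by [N] localizes the bound. The bounds for [M1] and [1 - M1]
   then add up to [d ^+ 2], where the triangle inequality would only give twice that. *)
have bnd w N : star N = N -> N * N = N -> nrm w <= d -> w * N = w ->
    pos (rs (d ^+ 2) * N - star w * w).
  move=> sN' NN' wd wN.
  have dw : pos (rs (d ^+ 2) - star w * w).
    apply: pos_rsB; first by rewrite starM starK.
    by rewrite unorm_starM ler_sqr ?nnegrE ?nrm_ge0.
  have := pos_conj N dw; congr (pos _).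
  have Nw : N * star w = star w by rewrite -{1}sN' -starM wN.
  by rewrite sN' mulrBr mulrBl -rsC -mulrA NN' mulrA Nw -mulrA wN.
have le2 : nrm ((M1 - M2) * (M1 - M2)) <= d ^+ 2.
  apply: nrm_le_pos; first by rewrite exprn_ge0.
    by rewrite sq; apply: posD; apply: pos_starM.
  have b1 := bnd u M1 sM1 MM1 ud; have b2 := bnd v _ (sN _ sM1) (NN _ MM1) vd.
  rewrite sq (_ : _ - _ = (rs (d ^+ 2) * M1 - star u * u) +
      (rs (d ^+ 2) * (1 - M1) - star v * v)); last by ncring.
  apply: posD; [apply: b1 | apply: b2]; rewrite /u /v -mulrA ?MM1 ?NN //.
rewrite nrm_sa2 ?starB ?sM1 ?sM2 // in le2.
by rewrite -ler_sqr ?nnegrE ?nrm_ge0.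
Qed.

(* [Q + star Q - 1] is invertible since its square is [1 + star d * d] with
   [d = Q - star Q]. *)
Lemma range_projection Q : Q * Q = Q ->
  exists P, [/\ star P = P, P * P = P, P * Q = Q & Q * P = P].
Proof.
move=> QQ; pose Z := Q + star Q - 1; pose d := Q - star Q.
have sQQ : star Q * star Q = star Q by rewrite -starM QQ.
have ZZ : Z * Z = 1 + star d * d.
  have -> : Z * Z = Q * Q + star Q * star Q + Q * star Q + star Q * Q
      - Q - Q - star Q - star Q + 1 by rewrite /Z; ncring.
  rewrite starB starK.
  have -> : (star Q - Q) * (Q - star Q) = star Q * Q - star Q * star Q - Q * Q
      + Q * star Q by ncring.
  by rewrite QQ sQQ; ncring.
have [V [ZV VZ V0 _ cV]] : exists V, [/\ Z * Z * V = 1, V * (Z * Z) = 1, pos V,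
    pos (1 - V) & commutant (Z * Z) V].
  by apply: ge1_inverse; rewrite ZZ addrAC subrr add0r; apply: pos_starM.
have VZc : V * Z = Z * V by apply: cV; rewrite /GRing.comm mulrA.
have sZ : star Z = Z by rewrite starB starD starK star1 [star Q + Q]addrC.
have ZQ : Z * Q = star Q * Q.
  have -> : Z * Q = Q * Q + star Q * Q - Q by rewrite /Z; ncring.
  by rewrite QQ; ncring.
have sQZ : star Q * Z = star Q * Q.
  have -> : star Q * Z = star Q * Q + star Q * star Q - star Q.
    by rewrite /Z; ncring.
  by rewrite sQQ; ncring.
(* [V] inverts [Z * Z] and commutes with [Z], so [Y] is the inverse of [Z]; the projection sought is
   [Q (Q + Q^* - 1)^-1]. *)
pose Y := Z * V; have ZY : Z * Y = 1 by rewrite /Y mulrA.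
have YZ : Y * Z = 1 by rewrite /Y -VZc -mulrA.
have sY : star Y = Y by rewrite /Y starM sZ pos_sa.
have QY : Q * Y = Y * star Q.
  by rewrite -[RHS]mulr1 -ZY !mulrA -(mulrA Y) sQZ -ZQ mulrA YZ mul1r.
have PQ : Q * Y * Q = Q by rewrite QY -mulrA -ZQ mulrA YZ mul1r.
exists (Q * Y); split=> //; last by rewrite mulrA QQ.
- by rewrite starM sY -QY.
- by rewrite mulrA PQ.
Qed.

(* With [Q = [[1, A], [0, 0]]] relative to the range of [P], one has
   [W = [[0, A], [0, 0]]], [b = [[B, 0], [0, 1]]] and
   [g = [[B + 1, 0], [A^*, 0]]]; the matched projection is the projection onto
   the range of [g], on which [star g * g] is [2 b (b + 1)]. *)
Lemma matched_projection P Q :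
  star P = P -> P * P = P -> P * Q = Q -> Q * P = P ->
  let W := Q - P in
  exists b e, [/\ pos (b - 1), b * b = 1 + W * star W,
    commutant (1 + W * star W) b,
    [/\ b * (b + 1) * e = 1, e * (b * (b + 1)) = 1
      & commutant (b * (b + 1)) e] &
    let g := P * (b + 1) + star W in
    let M := rs 2^-1 * (g * e * star g) in
    [/\ star M = M, M * M = M & pos (M * Q * M - M)]].
Proof.
move=> sP PP PQ QP W.
have PW : P * W = W by rewrite mulrBr PQ PP.
have WP : W * P = 0 by rewrite mulrBl QP PP subrr.
have sWP : star W * P = star W by rewrite -{2}PW starM sP.
have PsW : P * star W = 0 by rewrite -{1}sP -starM WP star0.
pose X := 1 + W * star W.
have X1 : pos (X - 1).
  by rewrite /X addrAC subrr add0r -{1}(starK W); apply: pos_starM.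
have [b [b1]] := nth_root_exists (ltn0Sn 1) X1; rewrite expr2 => bb cb.
have b0 := ge1_pos b1; have sb := pos_sa b0.
have bS1 : pos (b + 1 - 1) by rewrite addrK.
have bbS : GRing.comm b (b + 1) by apply: commrD.
have F1 : pos (b * (b + 1) - 1) by apply: ge1_mul.
have [e [Fe eF e0 _ ce]] := ge1_inverse F1.
exists b, e; split=> // g M.
have Pb : GRing.comm P b.
  apply/commr_sym/cb; rewrite /GRing.comm mulrDl mulrDr mul1r mulr1 mulrA PW.
  by rewrite -mulrA sWP.
have eb : GRing.comm e b by apply: ce; apply: comml_mul => //; apply: comml_add.
have eP : GRing.comm e P.
  apply: ce; apply: comml_mul; first exact: commr_sym.
  by apply: comml_add => //; apply: commr_sym.
have WW : W * star W = b * b - 1 by rewrite bb /X; ncring.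
have se := pos_sa e0.
have gP : g * P = g.
  by rewrite /g mulrDl sWP -mulrA mulrDl mul1r -Pb mulrDr PP mulrDr mulr1 mulrA
    PP.
have sg : star g = (b + 1) * P + W.
  by rewrite /g starD starM starD star1 sb sP starK.
have PWW : P * (b * b - 1) = b * b - 1 by rewrite -WW mulrA PW.
have Qg : Q * g = P * (b * (b + 1)).
  have -> : Q = P + W by rewrite /W; ncring.
  have -> : (P + W) * g =
      P * P * (b + 1) + P * star W + W * P * (b + 1) + W * star W.
    by rewrite /g; ncring.
  by rewrite PP PsW WP WW -PWW; ncring.
have gg : star g * g = P * (b * (b + 1)) + P * (b * (b + 1)).
  rewrite sg.
  have -> : ((b + 1) * P + W) * g =
      (b + 1) * (P * P) * (b + 1) + (b + 1) * (P * star W) + W * P * (b + 1)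
      + W * star W by rewrite /g; ncring.
  have bP : (b + 1) * P = P * (b + 1) by rewrite mulrDl mulrDr -Pb; ncring.
  by rewrite PP PsW WP WW -PWW bP; ncring.
have half2 : rs 2^-1 * (1 + 1) = 1.
  by rewrite -{1 2}rs1 -rsD -rsM -[RHS]rs1; congr rs; lra.
have half_double a : rs 2^-1 * (a + a) = a.
  by rewrite -[X in X + X]mul1r -mulrDl mulrA half2 mul1r.
have PFe : P * (b * (b + 1)) * e = P by rewrite -mulrA Fe mulr1.
have sM : star M = M.
  by rewrite /M starM star_rs -rsC !starM starK se !mulrA.
have MM : M * M = M.
  have -> : M * M = rs 2^-1 * (g * e * (rs 2^-1 * (star g * g)) * e * star g).
    by rewrite [rs 2^-1 * (star g * g)]mulrA (rsC _ (star g)) /M; ncring.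
  rewrite gg half_double.
  have -> : g * e * (P * (b * (b + 1))) * e = g * e * (P * (b * (b + 1)) * e).
    by ncring.
  by rewrite PFe -(mulrA g e) eP (mulrA g) gP.
split=> //.
have eS : e * (b + 1) = (b + 1) * e by rewrite mulrDr mulrDl eb mulr1 mul1r.
have MQM : M * Q * M = rs 2^-1 * (rs 2^-1 * (g * ((b + 1) * e) * star g)).
  have -> : M * Q * M =
      rs 2^-1 * (rs 2^-1 * (g * e * (star g * (Q * g)) * e * star g)).
    have -> : rs 2^-1 * (rs 2^-1 * (g * e * (star g * (Q * g)) * e * star g)) =
        rs 2^-1 * ((rs 2^-1 * (g * e * star g * Q)) * (g * e * star g)) by
          ncring.
    by rewrite (rsC _ (g * e * star g * Q)) /M; ncring.
  have -> : star g * (Q * g) = (b + 1) * (P * (b * (b + 1))).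
    rewrite Qg sg mulrDl (mulrA W) WP mul0r addr0.
    by rewrite -(mulrA (b + 1)) (mulrA P P) PP.
  congr (_ * (_ * _)).
  have -> : g * e * ((b + 1) * (P * (b * (b + 1)))) * e =
    g * (e * (b + 1)) * (P * (b * (b + 1)) * e).
    by ncring.
  have SeP : GRing.comm ((b + 1) * e) P.
    by apply: comml_mul => //; apply: comml_add => //; apply: commr_sym.
  by rewrite PFe eS -(mulrA g) SeP (mulrA g) gP.
(* Writing [M] as a quarter of [g (2 e) g^*] leaves the middle factor [(b + 1) e - 2 e = (b - 1) e],
   a product of commuting positive elements. *)
have -> : M * Q * M - M = rs 2^-1 * (rs 2^-1 * (g * ((b - 1) * e) * star g)).
  rewrite MQM.
  have -> : M = rs 2^-1 * (rs 2^-1 * (g * e * star g + g * e * star g)).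
    by rewrite half_double.
  by ncring.
have half0 : 0 <= 2^-1 :> R by rewrite invr_ge0.
apply: posZ => //; apply: posZ => //; rewrite -{1}(starK g); apply: pos_conj.
by apply: pos_mul => //; apply: comml_sub => //; exact: commr_sym.
Qed.
End UnitalCStarTheory.

(** * Hilbert modules and their adjointable operators *)

Section RealNorm.
Variables (R : realType).

Definition nr (V : normedModType R[i]) (x : V) : R := complex.Re `|x|.

Section NormedModule.
Variable V : normedModType R[i].
Implicit Types x y : V.

Lemma nrE x : `|x| = (nr x)%:C%C.
Proof. by rewrite /nr RRe_real // ger0_real. Qed.

Lemma nr_ge0 x : 0 <= nr x.
Proof. by rewrite -ler0c -nrE. Qed.

Lemma nrD x y : nr (x + y) <= nr x + nr y.
Proof. by rewrite -lecR rmorphD /= -!nrE ler_normD. Qed.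

Lemma nrN x : nr (- x) = nr x.
Proof. by rewrite /nr normrN. Qed.

Lemma nr0 : nr (0 : V) = 0.
Proof. by rewrite /nr normr0. Qed.

Lemma nr_eq0 x : nr x = 0 -> x = 0.
Proof. by move=> x0; apply/eqP; rewrite -normr_eq0 nrE x0. Qed.

Lemma nrZ (z : R[i]) x : nr (z *: x) = complex.Re `|z| * nr x.
Proof.
by rewrite /nr normrZ nrE [`|z|]normc_def -rmorphM.
Qed.

Lemma nrZr (t : R) x : nr (t%:C%C *: x) = `|t| * nr x.
Proof. by rewrite nrZ normc_def /= expr0n addr0 sqrtr_sqr. Qed.

Lemma nrZi x : nr ('i *: x) = nr x.
Proof. by rewrite nrZ normCi mul1r. Qed.

End NormedModule.

Lemma half_complex : 2^-1 = (2^-1 : R)%:C%C.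
Proof. by rewrite fmorphV rmorph_nat. Qed.

Lemma nr_half (V : normedModType R[i]) (v : V) : nr (2^-1 *: v) = nr v / 2.
Proof. by rewrite half_complex nrZr ger0_norm ?invr_ge0 // mulrC. Qed.

Lemma scaler_half_double (V : lmodType R[i]) (v : V) :
  2^-1 *: v + 2^-1 *: v = v.
Proof. by rewrite -scalerDl -[X in X + X]mul1r -splitr scale1r. Qed.

Lemma nr_double (V : normedModType R[i]) (v : V) : nr (v + v) = 2 * nr v.
Proof.
by rewrite -{3}(scaler_half_double v) -scalerDr nr_half mulrC divfK //
  pnatr_eq0.
Qed.

Lemma nr_complete (V : completeNormedModType R[i]) : ncomplete (@nr V).
Proof.
move=> u u_cauchy.
have u_cvg : cvg (u @ \oo).
  apply/cauchy_cvgP/cauchy_exP => e e0.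
  have [e' e'0 ee'] : exists2 e' : R, 0 < e' & e = e'%:C%C.
    by exists (complex.Re e);
      rewrite ?RRe_real ?gtr0_real // -ltcR RRe_real ?gtr0_real.
  have [n0 h] := u_cauchy _ (divr_gt0 e'0 (ltr0Sn _ 1)).
  exists (u n0), n0 => // n nn0; rewrite /= -ball_normE /= nrE ee' ltcR.
  apply: le_lt_trans (h _ _ (leqnn _) nn0) _; lra.
exists (lim (u @ \oo)) => e e0.
have /cvgrPdist_le/(_ e%:C%C) := u_cvg; rewrite ltcR => /(_ e0) [n0 _ h].
by exists n0 => n /h; rewrite distrC nrE lecR.
Qed.

End RealNorm.

(** * The Cauchy-Schwarz inequality and boundedness of adjointable operators *)

Section HilbertModule.
Variables (R : realType) (A : cstarAlgType R) (H : hilbertModType A).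
Implicit Types (a b : A) (x y z : H) (S T : 'L(H)).

Lemma cmulNl a b : cmul (- a) b = - cmul a b.
Proof. by rewrite -scaleN1r cmulZl scaleN1r. Qed.

Lemma cmulNr a b : cmul a (- b) = - cmul a b.
Proof. by rewrite -scaleN1r cmulZr scaleN1r. Qed.

Lemma cstarN a : cstar (- a) = - cstar a.
Proof. by rewrite -scaleN1r cstarZ rmorphN1 scaleN1r. Qed.

Lemma cmulBl a b (c : A) : cmul (a - b) c = cmul a c - cmul b c.
Proof. by rewrite cmulDl cmulNl. Qed.

Lemma cmulBr a b (c : A) : cmul a (b - c) = cmul a b - cmul a c.
Proof. by rewrite cmulDr cmulNr. Qed.

Lemma cmul0l a : cmul 0 a = 0.
Proof. by rewrite -[X in cmul X _](subrr a) cmulBl subrr. Qed.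

Lemma cmul0r a : cmul a 0 = 0.
Proof. by rewrite -[X in cmul _ X](subrr a) cmulBr subrr. Qed.

Lemma cstarB a b : cstar (a - b) = cstar a - cstar b.
Proof. by rewrite cstarD cstarN. Qed.

Lemma cstar0 : cstar (0 : A) = 0.
Proof. by rewrite -[X in cstar X](subrr 0) cstarB subrr. Qed.

Lemma nr_cmul a b : nr (cmul a b) <= nr a * nr b.
Proof. by rewrite -lecR rmorphM /= -!nrE norm_cmul_le. Qed.

Lemma nr_cstar_cmul a : nr (cmul (cstar a) a) = nr a ^+ 2.
Proof. by apply: complexI; rewrite rmorphXn /= -!nrE norm_cstar_cmul. Qed.

Lemma nr_cstar a : nr (cstar a) = nr a.
Proof.
have le_star b : nr b <= nr (cstar b).
  have := nr_cmul (cstar b) b; rewrite nr_cstar_cmul.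
  by have := nr_ge0 b; have := nr_ge0 (cstar b); nra.
by apply/eqP; rewrite eq_le le_star andbT -{2}(cstarK a) le_star.
Qed.

Lemma nr_inner x : nr (inner x x) = nr x ^+ 2.
Proof. by apply: complexI; rewrite rmorphXn /= -!nrE norm_inner. Qed.

Lemma innerBr x y z : inner x (y - z) = inner x y - inner x z.
Proof. by rewrite innerDr -[- z]scaleN1r innerZr scaleN1r. Qed.

Lemma innerBl x y z : inner (x - y) z = inner x z - inner y z.
Proof. by rewrite innerDl -[- y]scaleN1r innerZl rmorphN1 scaleN1r. Qed.

(* Polarization; the constant is improved to 1 in [inner_unit_le1]. *)
Lemma inner_unit_le6 x y : nr x <= 1 -> nr y <= 1 -> nr (inner x y) <= 6.
Proof.
move=> x1 y1; pose s y := inner x y + inner y x.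
(* The constant is 4 + 1 + 1; any finite bound would do, as it only ensures that the supremum in
   [inner_unit_le1] exists. *)
have s6 z : nr z <= 1 -> nr (s z) <= 6.
  move=> z1; have -> : s z = inner (x + z) (x + z) - inner x x - inner z z.
    by rewrite innerDr !innerDl /s; zmodule.
  have := nrD (inner (x + z) (x + z) - inner x x) (- inner z z).
  have := nrD (inner (x + z) (x + z)) (- inner x x).
  rewrite !nrN !nr_inner; have := nrD x z.
  by have := nr_ge0 x; have := nr_ge0 z; have := nr_ge0 (x + z); nra.
have iy1 : nr ('i *: y) <= 1 by rewrite nrZi.
have : nr (inner x y + inner x y) <= 12.
  have -> : inner x y + inner x y = s y - 'i *: s ('i *: y).
    rewrite /s innerZr innerZl conjCi scalerDr !scalerA mulrN -!expr2 sqrCi.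
    by rewrite opprK scaleN1r scale1r; zmodule.
  have := nrD (s y) (- ('i *: s ('i *: y))); rewrite nrN nrZi.
  by have := s6 _ y1; have := s6 _ iy1; lra.
by rewrite nr_double; lra.
Qed.

Lemma ncvg_cmul_comm (u : nat -> A) (l a : A) :
  (forall n, cmul (u n) a = cmul a (u n)) -> ncvg (@nr R A) u l ->
  cmul l a = cmul a l.
Proof.
move=> ua ul; apply/subr0_eq/nr_eq0/eqP; rewrite eq_le nr_ge0 andbT.
apply/ler_addgt0Pr => e e0; rewrite add0r.
have c0 : 0 < 2 * nr a + 1 by have := nr_ge0 a; lra.
have [n0 /(_ _ (leqnn _)) h] := ul _ (divr_gt0 e0 c0).
have -> : cmul l a - cmul a l = cmul a (u n0 - l) - cmul (u n0 - l) a.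
  by rewrite cmulBl cmulBr ua; zmodule.
have := nrD (cmul a (u n0 - l)) (- cmul (u n0 - l) a); rewrite nrN.
have := nr_cmul a (u n0 - l); have := nr_cmul (u n0 - l) a.
rewrite ler_pdivlMr // in h; have := nr_ge0 a; have := nr_ge0 (u n0 - l); nra.
Qed.

Lemma ncvg_cstar (u : nat -> A) (l : A) :
  (forall n, cstar (u n) = u n) -> ncvg (@nr R A) u l -> cstar l = l.
Proof.
move=> us ul; apply/subr0_eq/nr_eq0/eqP; rewrite eq_le nr_ge0 andbT.
apply/ler_addgt0Pr => e e0; rewrite add0r.
have e20 : 0 < e / 2 by lra.
have [n0 /(_ _ (leqnn _)) h] := ul _ e20.
have -> : cstar l - l = (u n0 - l) - cstar (u n0 - l).
  by rewrite cstarB us; zmodule.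
have := nrD (u n0 - l) (- cstar (u n0 - l)); rewrite nrN nr_cstar; lra.
Qed.

(* [1 - x w <x, .>] is a square root of [1 - theta ^+ 2] where
   [theta = x <x, .>], so that [theta +- i (1 - x w <x, .>)] are isometries. *)
Lemma theta_contraction x y : nr x <= 1 -> nr (ract x (inner x y)) <= nr y.
Proof.
move=> x1; pose p := inner x x; pose b := inner x y.
have p1 : nr p <= 1 by rewrite /p nr_inner expr_le1 ?nr_ge0.
have sp : cstar p = p by rewrite inner_star.
(* The equation is [w + w = p + w p w]. With [theta ^+ 2 = x p <x, .>] it says that [1 - x w <x, .>]
   squares to [1 - theta ^+ 2], without a unit in [A]. *)
have [||||||||||w [sw pw] eqw] := @half_square_fixpoint R A (@nr R A)
    (fun a => 2^-1 *: a) (fun a c => cmul (cmul a p) c) p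
    (fun w => cstar w = w /\ cmul w p = cmul p w)
    (@nrD R A) (@nrN R A) (@nr0 R A) (@nr_eq0 R A) (@nr_complete R A).
- exact: scaler_half_double.
- by move=> a c; rewrite scalerBr.
- exact: nr_half.
- by move=> a c d; rewrite !cmulBl.
- by move=> a c d; rewrite !cmulBr.
- move=> a c; apply: le_trans (nr_cmul _ _) _; rewrite ler_wpM2r ?nr_ge0 //.
  by apply: le_trans (nr_cmul _ _) _; rewrite ler_piMr ?nr_ge0.
- exact: p1.
- by rewrite cstar0 cmul0l cmul0r.
- move=> a [sa pa]; split.
    rewrite cstarZ cstarD !cstarM sa sp cmulA half_complex.
    by congr (_ *: _); apply: CrealP; rewrite complex_real.
  by rewrite cmulZl cmulZr cmulDl cmulDr -!cmulA pa !cmulA pa.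
- move=> u l uD ul; split; first by apply: ncvg_cstar ul => n; case: (uD n).
  by apply: ncvg_cmul_comm ul => n; case: (uD n).
(* [u e] is [(theta + e (1 - x w <x, .>)) y], so [theta y] is the mean of [u 'i] and [u (- 'i)]. *)
pose v e := b - e *: cmul w b; pose u (e : R[i]) := ract x (v e) + e *: y.
have nu e : Num.conj e = - e -> e * e = -1 -> nr (u e) = nr y.
  move=> ce ee; suff uu : inner (u e) (u e) = inner y y.
    apply/eqP; rewrite -(@eqrXn2 _ 2) ?nr_ge0 //.
    by rewrite -!nr_inner uu.
  pose q := cmul (cstar b) (cmul w b).
  have sv : cstar (v e) = cstar b + e *: cmul (cstar b) w.
    by rewrite cstarB cstarZ ce cstarM sw scaleNr opprK.
  have e1 : inner (ract x (v e)) (e *: y) = e *: cmul (cstar b) b - q.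
    rewrite innerZr innerMl -/b sv cmulDl cmulZl scalerDr scalerA ee scaleN1r.
    by rewrite /q cmulA.
  have e2 : inner (e *: y) (ract x (v e)) = - (e *: cmul (cstar b) b) - q.
    rewrite innerZl innerMr -inner_star -/b ce cmulBr cmulZr scalerBr !scalerA.
    by rewrite mulNr ee opprK scale1r scaleNr.
  have e3 : inner (ract x (v e)) (ract x (v e)) = q + q.
    rewrite innerMl innerMr -/p sv /q -cmulDr -cmulDl eqw /v.
    rewrite !(cmulDl, cmulDr, cmulBr, cmulZl, cmulZr, scalerBr).
    rewrite !scalerA ee scaleN1r -!cmulA.
    have -> : cmul w (cmul p b) = cmul p (cmul w b) by rewrite !cmulA pw.
    by zmodule.
  rewrite /u innerDl !innerDr e1 e2 e3 innerZl innerZr ce scalerA mulNr ee.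
  by rewrite opprK scale1r; zmodule.
have [ni nNi] : nr (u 'i) = nr y /\ nr (u (- 'i)) = nr y.
  by split; apply: nu; rewrite ?rmorphN /= ?conjCi ?mulrNN -?expr2 ?sqrCi.
have : nr (ract x b + ract x b) = nr (u 'i + u (- 'i)).
  congr nr; rewrite /u /v !scaleNr addrACA subrr addr0 -!ractDr; congr ract.
  by rewrite opprK addrACA addNr addr0.
rewrite nr_double; have := nrD (u 'i) (u (- 'i)); lra.
Qed.

(* If [K] is the supremum of [|<x, y>|] over the unit ball, then
   [|<x, y>| ^+ 2 = |<y, x <x, y>>| <= K], hence [K ^+ 2 <= K]. *)
Lemma inner_unit_le1 x y : nr x <= 1 -> nr y <= 1 -> nr (inner x y) <= 1.
Proof.
move=> x1 y1.
pose S := [set r : R | exists x y : H,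
  [/\ nr x <= 1, nr y <= 1 & r = nr (inner x y)]].
have S6 : has_ubound S by exists 6 => _ [x' [y' [x1' y1' ->]]];
  exact: inner_unit_le6.
have sqS r : S r -> r ^+ 2 <= sup S.
  move=> [x' [y' [x1' y1' ->]]]; apply: ub_le_sup => //.
  exists y', (ract x' (inner x' y')); split=> //.
    exact: le_trans (theta_contraction _ _) _.
  by rewrite innerMr -nr_cstar_cmul inner_star.
have Sxy : S (nr (inner x y)) by exists x, y.
have supS : sup S <= Num.sqrt (sup S).
  apply: sup_le_ub; first by exists (nr (inner x y)).
  move=> r Sr; rewrite -[r]ger0_norm; last by case: Sr => [? [? [_ _ ->]]];
    exact: nr_ge0.
  by rewrite -sqrtr_sqr ler_wsqrtr // sqS.
have xyS : nr (inner x y) <= sup S by apply: ub_le_sup.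
have S0 : 0 <= sup S := le_trans (nr_ge0 _) xyS.
have := sqr_sqrtr S0; have := sqrtr_ge0 (sup S); nra.
Qed.

Lemma inner_le x y : nr (inner x y) <= nr x * nr y.
Proof.
have [x0|x_neq0] := eqVneq (nr x) 0.
  by rewrite (nr_eq0 x0) inner0l !nr0 mul0r.
have [y0|y_neq0] := eqVneq (nr y) 0.
  by rewrite (nr_eq0 y0) inner0r !nr0 mulr0.
have x_gt0 : 0 < nr x by rewrite lt_def x_neq0 nr_ge0.
have y_gt0 : 0 < nr y by rewrite lt_def y_neq0 nr_ge0.
have unit z : 0 < nr z -> nr ((nr z)^-1%:C%C *: z) <= 1.
  by move=> z0; rewrite nrZr ger0_norm ?invr_ge0 ?nr_ge0 // mulVf // gt_eqF.
have := inner_unit_le1 (unit _ x_gt0) (unit _ y_gt0).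
have conjE (t : R) : Num.conj (t%:C%C : R[i]) = t%:C%C.
  by apply: CrealP; rewrite complex_real.
rewrite innerZl innerZr scalerA conjE -rmorphM nrZr ger0_norm ?mulr_ge0
  ?invr_ge0 ?nr_ge0 //.
by rewrite -invfM mulrC ler_pdivrMr ?mul1r // mulr_gt0.
Qed.

(** Take [e] of norm [d] along [z]: twice [<z, e>] is the difference of the inner products of [z]
    with [y + e] and [y - e], so one of them is large. The condition on [d] sits under the
    existential to let [cid] define a step function directly. *)
Lemma inner_hump z y (d : R) : exists y',
  0 <= d -> nr (y' - y) <= d /\ d * nr z <= nr (inner z y').
Proof.
have [d0|] := leP 0 d; last by exists y.
have [z0|z_neq0] := eqVneq (nr z) 0.
  by exists y => _; rewrite subrr nr0 z0 mulr0 nr_ge0.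
have z_gt0 : 0 < nr z by rewrite lt_def z_neq0 nr_ge0.
pose e := (d / nr z)%:C%C *: z.
have ed : nr e = d by rewrite nrZr ger0_norm ?divr_ge0 ?nr_ge0 // divfK.
have zed : nr (inner z e) = d * nr z.
  rewrite innerZr nrZr nr_inner ger0_norm ?divr_ge0 ?nr_ge0 //.
  by rewrite expr2 mulrA divfK.
have [|h] := leP (d * nr z) (nr (inner z (y + e))).
  by exists (y + e) => _; rewrite addrC addKr ed.
exists (y - e) => _; rewrite addrC addKr nrN ed; split=> //.
have : nr (inner z e + inner z e) <=
    nr (inner z (y + e)) + nr (inner z (y - e)).
  have -> : inner z e + inner z e = inner z (y + e) - inner z (y - e).
    by rewrite innerDr innerBr; zmodule.
  by rewrite -[nr (inner z (y - e))]nrN nrD.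
by rewrite nr_double zed; lra.
Qed.

(* Gliding hump: if [nr (T (u n)) > 2 n 3 ^ n] on the unit ball, the sum of the
   perturbations given by [inner_hump] at scale [3 ^- n] is a vector at which
   [adj T] cannot be finite. *)
Lemma adjop_bounded_unit T : exists c, forall x, nr x <= 1 -> nr (T x) <= c.
Proof.
apply: contrapT => unb.
have /choice[u uP] n : exists x, nr x <= 1 /\ 2 * n%:R * 3 ^+ n < nr (T x).
  apply: contrapT => h; apply: unb; exists (2 * n%:R * 3 ^+ n) => x x1.
  by rewrite leNgt; apply/negP => xT; apply: h; exists x.
pose dl n : R := 3 ^- n.
have dl0 n : 0 <= dl n by rewrite invr_ge0 exprn_ge0.
have dlS n : dl n.+1 = dl n / 3 by rewrite /dl exprSr invfM.
pose step n y := sval (cid (inner_hump (T (u n)) y (dl n))).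
have stepP n y := svalP (cid (inner_hump (T (u n)) y (dl n))) (dl0 n).
pose fix y n : H := if n is n'.+1 then step n' (y n') else 0.
(* Minus the geometric tail: [z n.+1 - z n = dl n], and the perturbations after step [n] add up to
   at most [- z n.+1 = dl n / 2]. They spoil at most half of the hump [dl n * nr (T (u n))], and the
   other half exceeds [n]. *)
pose z n := - (3 / 2) * dl n.
have yz n : nr (y n.+1 - y n) <= z n.+1 - z n.
  apply: le_trans (stepP n (y n)).1 _; rewrite /z dlS; lra.
have z0 n : z n <= 0 by rewrite /z; have := dl0 n; lra.
have [l yl] := majorant_cvg (@nrD R H) (@nrN R H) (@nr0 R H) (@nr_complete R H)
  yz z0.
have big n : n%:R <= nr (adj T l).
  have tail := majorant_tail (@nrD R H) (@nrN R H) (@nr0 R H) n.+1 yz z0 yl.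
  have [u1 uT] := uP n; have hump := (stepP n (y n)).2.
  have ineq1 : nr (inner (T (u n)) l) <= nr (adj T l).
    rewrite adjP; apply: le_trans (inner_le _ _) _.
    by rewrite ler_piMl ?nr_ge0.
  have ineq2 : nr (inner (T (u n)) (y n.+1)) <=
      nr (inner (T (u n)) l) + nr (T (u n)) * nr (l - y n.+1).
    have -> : inner (T (u n)) (y n.+1) =
        inner (T (u n)) l - inner (T (u n)) (l - y n.+1).
      by rewrite innerBr; zmodule.
    apply: le_trans (nrD _ _) _; rewrite nrN lerD2l; exact: inner_le.
  have ineq3 : nr (T (u n)) * nr (l - y n.+1) <= nr (T (u n)) * (dl n / 2).
    by apply: ler_wpM2l; rewrite ?nr_ge0 //; move: tail; rewrite /z dlS; lra.
  have ineq4 : n%:R <= dl n * nr (T (u n)) / 2.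
    have e3 : dl n * (2 * n%:R * 3 ^+ n) = 2 * n%:R.
      by rewrite mulrCA /dl mulVf ?mulr1 // expf_neq0 // pnatr_eq0.
    by have := ler_wpM2l (dl0 n) (ltW uT); rewrite e3; lra.
  rewrite -/(step n (y n)) in hump;
    rewrite -[y n.+1]/(step n (y n)) in ineq2 ineq3.
  rewrite /step in ineq2 ineq3; lra.
have := big (Num.truncn (nr (adj T l))).+1.
by rewrite leNgt truncnS_gt.
Qed.

End HilbertModule.

Section Adjoints.
Variables (R : realType) (A : cstarAlgType R).
Implicit Types E F G : innerModType A.

Lemma adj_eq E F (T : 'L(E, F)) (S : 'L(F, E)) :
  (forall x y, inner (T x) y = inner x (S y)) -> adj T = S.
Proof.
by move=> TS; apply: adjop_ext => y; apply: inner_inj => x; rewrite -adjP TS.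
Qed.

Lemma adjK E F (T : 'L(E, F)) : adj (adj T) = T.
Proof. by apply: adj_eq => x y; rewrite -adjPr. Qed.

Lemma adjD E F : {morph (@adj R A E F) : S T / S + T}.
Proof. by move=> S T; apply: adj_eq => x y; rewrite innerDl innerDr !adjP. Qed.

Lemma adj_comp E F G (S : 'L(F, G)) (T : 'L(E, F)) :
  adj (S \oL T) = adj T \oL adj S.
Proof. by apply: adj_eq => x y; rewrite -[(S \oL T) x]/(S (T x)) !adjP. Qed.

End Adjoints.

(** * The C*-algebra L(H) *)

Section OperatorAlgebra.
Variables (R : realType) (A : cstarAlgType R) (H : hilbertModType A).
Implicit Types (x y z : H) (S T : 'L(H)).

Lemma adjop_ubound T :
  has_ubound [set complex.Re `|T x| | x in [set x : H | `|x| <= 1]].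
Proof.
have [c cT] := adjop_bounded_unit T; exists c => _ [x /= x1 <-].
by apply: cT; rewrite -lecR -nrE.
Qed.

Lemma normL_unit T x : nr x <= 1 -> nr (T x) <= normL T.
Proof.
move=> x1; apply: ub_le_sup; first exact: adjop_ubound.
by exists x => //=; rewrite nrE lecR.
Qed.

Lemma normL_ge0 T : 0 <= normL T.
Proof.
by rewrite (le_trans (nr_ge0 (T 0))) // normL_unit // nr0.
Qed.

Lemma normL_bound T x : nr (T x) <= normL T * nr x.
Proof.
have [x0|x_neq0] := eqVneq (nr x) 0.
  by rewrite (nr_eq0 x0) adjop0 nr0 mulr0.
have x_gt0 : 0 < nr x by rewrite lt_def x_neq0 nr_ge0.
have V0 : 0 <= (nr x)^-1 by rewrite invr_ge0 nr_ge0.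
have := @normL_unit T ((nr x)^-1%:C%C *: x).
rewrite adjopZ !nrZr ger0_norm // mulVf // lexx => /(_ isT).
by rewrite mulrC ler_pdivrMr.
Qed.

Lemma normL_le T c : (forall x, nr x <= 1 -> nr (T x) <= c) -> normL T <= c.
Proof.
move=> cT; apply: sup_le_ub.
  by exists (complex.Re `|T 0|); exists 0 => //=; rewrite normr0.
by move=> _ [x /= x1 <-]; apply: cT; rewrite -lecR -nrE.
Qed.

Lemma normLD S T : normL (S + T) <= normL S + normL T.
Proof.
apply: normL_le => x x1; apply: le_trans (nrD _ _) _.
by apply: lerD; apply: normL_unit.
Qed.

Lemma normL_scal (z : R[i]) T : normL (z *: (1 : 'L(H)) * T) =
  complex.Re `|z| * normL T.
Proof.
have z0 : 0 <= complex.Re `|z| by rewrite normc_def /= sqrtr_ge0.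
apply/eqP; rewrite eq_le; apply/andP; split.
  by apply: normL_le => x x1; rewrite nrZ; apply: ler_wpM2l => //;
    exact: (normL_unit T x1).
have [->|z_neq0] := eqVneq (complex.Re `|z|) 0;
  first by rewrite mul0r normL_ge0.
have z_gt0 : 0 < complex.Re `|z| by rewrite lt_def z_neq0.
rewrite mulrC -ler_pdivlMr //; apply: normL_le => x x1.
have := normL_unit (z *: (1 : 'L(H)) * T) x1; rewrite /= nrZ => le_zT.
by rewrite ler_pdivlMr // mulrC.
Qed.

Lemma normLM S T : normL (S * T) <= normL S * normL T.
Proof.
apply: normL_le => x x1; apply: le_trans (normL_bound S (T x)) _.
by apply: ler_wpM2l (normL_unit T x1); exact: normL_ge0.
Qed.

Lemma normL_adj_le T : normL (adj T) <= normL T.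
Proof.
apply: normL_le => x x1; have := inner_le (T (adj T x)) x.
rewrite adjP nr_inner => h.
have {}h : nr (adj T x) ^+ 2 <= normL T * nr (adj T x).
  apply: le_trans (normL_bound T (adj T x)); apply: le_trans h _.
  by rewrite ler_piMr ?nr_ge0.
by have := nr_ge0 (adj T x); have := normL_ge0 T; nra.
Qed.

Lemma normL_adjM T : normL (adj T * T) = normL T ^+ 2.
Proof.
apply/eqP; rewrite eq_le; apply/andP; split.
  apply: le_trans (normLM _ _) _.
  by rewrite expr2 ler_wpM2r ?normL_ge0 // normL_adj_le.
rewrite -[leRHS]sqr_sqrtr ?normL_ge0 //
  ler_sqr ?nnegrE ?normL_ge0 ?sqrtr_ge0 //.
apply: normL_le => x x1; rewrite -[nr _]ger0_norm ?nr_ge0 // -sqrtr_sqr.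
rewrite ler_wsqrtr // -nr_inner adjP; apply: le_trans (inner_le _ _) _.
by rewrite -[leRHS]mul1r; apply: ler_pM; rewrite ?nr_ge0 //;
  exact: (normL_unit (adj T * T) x1).
Qed.

Lemma normL_eq0 T : normL T = 0 -> T = 0.
Proof.
move=> T0; apply: adjop_ext => x; apply: nr_eq0; apply/eqP.
by rewrite eq_le nr_ge0 andbT; have := normL_bound T x; rewrite T0 mul0r.
Qed.

Lemma adj_scal (z : R[i]) : adj (z *: (1 : 'L(H))) = Num.conj z *: (1 : 'L(H)).
Proof. by apply: adj_eq => x y /=; rewrite innerZl innerZr. Qed.

Lemma normLN T : normL (- T) = normL T.
Proof.
by congr (sup _); apply/seteqP; split=> _ [x x1 <-]; exists x;
  rewrite //= scaleN1r normrN.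
Qed.

(** The adjoints form a Cauchy sequence too, and their pointwise limit is an adjoint of the
    pointwise limit [f]. Norm convergence follows since the Cauchy index [n0] does not depend on the
    vector. *)
Lemma normL_complete : ncomplete (@normL R A H H).
Proof.
move=> u u_cauchy.
have ux_cauchy (v : nat -> 'L(H)) : ncauchy (@normL R A H H) v ->
    forall x, ncauchy (@nr R H) (fun n => v n x).
  move=> vc x e e0; have c0 : 0 < nr x + 1 by have := nr_ge0 x; lra.
  have [n0 h] := vc _ (divr_gt0 e0 c0); exists n0 => m n mn nn.
  have := normL_bound (v m - v n) x; have := h _ _ mn nn.
  rewrite ler_pdivlMr //= scaleN1r.
  by have := nr_ge0 x; have := normL_ge0 (v m - v n); nra.
have au_cauchy : ncauchy (@normL R A H H) (fun n => adj (u n)).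
  move=> e /u_cauchy[n0 h]; exists n0 => m n mn nn.
  apply: le_trans (h _ _ mn nn).
  have -> : adj (u m) - adj (u n) = adj (u m - u n).
    apply/esym/adj_eq => x y /=.
    by rewrite !scaleN1r innerBl innerBr !adjP.
  exact: normL_adj_le.
have /choice[f fP] x := nr_complete (ux_cauchy _ u_cauchy x).
have /choice[g gP] x := nr_complete (ux_cauchy _ au_cauchy x).
have fg x y : inner (f x) y = inner x (g y).
  apply/subr0_eq/nr_eq0/eqP; rewrite eq_le nr_ge0 andbT.
  apply/ler_addgt0Pr => e e0; rewrite add0r.
  have c0 : 0 < nr x + nr y + 1 by have := nr_ge0 x; have := nr_ge0 y; lra.
  have [n1 h1] := fP x _ (divr_gt0 e0 c0);
    have [n2 h2] := gP y _ (divr_gt0 e0 c0).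
  have {h1} := h1 _ (leq_maxl n1 n2); have {h2} := h2 _ (leq_maxr n1 n2).
  set n := maxn n1 n2; rewrite !ler_pdivlMr // => h2 h1.
  have -> : inner (f x) y - inner x (g y) =
      inner x (adj (u n) y - g y) - inner (u n x - f x) y.
    by rewrite innerBl innerBr adjP opprB [RHS]addrC subrKA.
  have := nrD (inner x (adj (u n) y - g y)) (- inner (u n x - f x) y).
  rewrite nrN; have := inner_le x (adj (u n) y - g y).
  have := inner_le (u n x - f x) y.
  have := nr_ge0 x; have := nr_ge0 y.
  by have := nr_ge0 (u n x - f x); have := nr_ge0 (adj (u n) y - g y); nra.
have fadj : exists S : H -> H, forall x y, inner (f x) y = inner x (S y).
  by exists g.
exists (AdjOp fadj) => e /[dup] e0 /u_cauchy[n0 h]; exists n0 => n nn.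
apply: normL_le => x x1 /=; rewrite scaleN1r; apply/ler_addgt0Pr => e' e'0.
have [n1 h1] := fP x _ e'0.
have {h1} := h1 _ (leq_maxl n1 n0); have := h _ _ nn (leq_maxr n1 n0).
set m := maxn _ _ => h2 h1.
have -> : u n x - f x = (u n - u m) x + (u m x - f x).
  by rewrite /= scaleN1r; zmodule.
apply: le_trans (nrD _ _) _; apply: lerD h1.
exact: le_trans (normL_unit _ x1) h2.
Qed.

Lemma scal_addL : {morph (fun z : R[i] => z *: (1 : 'L(H))) : y z / y + z}.
Proof. by move=> y z; rewrite scalerDl. Qed.

Lemma scal_mulL : {morph (fun z : R[i] => z *: (1 : 'L(H))) : y z / y * z}.
Proof. by move=> y z; apply: adjop_ext => x /=; rewrite scalerA. Qed.

Lemma scal_commL (z : R[i]) T : z *: (1 : 'L(H)) * T = T * (z *: (1 : 'L(H))).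
Proof. by apply: adjop_ext => x /=; rewrite adjopZ. Qed.

HB.instance Definition _ := isUnitalCStar.Build R 'L(H)
  scal_addL scal_mulL (scale1r (1 : 'L(H))) scal_commL
  (@adjK R A H H) (@adjD R A H H)
  (@adj_comp R A H H H) adj_scal
  normLD normL_scal normLM normL_adjM normL_eq0 normL_complete.

End OperatorAlgebra.

(** * The matched projection *)

Section Submodules.
Variables (R : realType) (A : cstarAlgType R).
Implicit Types E F : innerModType A.

(** Each projection fixes the range of the other, so [P \oL P' = P'] and [P' \oL P = P]; taking
    adjoints in the first identifies them. This determines the value chosen by [rprojL]. *)
Lemma projection_eq_range E (P P' : 'L(E)) :
  projectionL P -> projectionL P' -> range P = range P' -> P = P'.
Proof.
move=> [PP sP] [PP' sP'] PrP'.
have fix_range (Q Q' : 'L(E)) : idempotentL Q -> range Q = range Q' ->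
    forall x, Q (Q' x) = Q' x.
  move=> QQ QQ' x; have : range Q (Q' x) by rewrite QQ'; exists x.
  by move=> [y _ <-]; rewrite -[RHS]/(Q y) -[in RHS]QQ.
have PP'E : P \oL P' = P'.
  by apply: adjop_ext => x; apply: (fix_range P P' PP PrP').
have P'PE : P' \oL P = P.
  by apply: adjop_ext => x; apply: (fix_range P' P PP' (esym PrP')).
by have := congr1 (@adj R A E E) PP'E; rewrite adj_comp sP sP' P'PE.
Qed.

Lemma rprojL_eq E (Q P : 'L(E)) :
  projectionL P -> P * Q = Q -> Q * P = P -> rprojL Q = P.
Proof.
move=> projP PQ QP; have rP : range P = range Q.
  apply/seteqP; split=> _ [x _ <-].
    by exists (P x) => //; rewrite -[in RHS]QP.
  by exists (Q x) => //; rewrite -[in RHS]PQ.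
apply: xget_unique => // P' [projP' rP'].
by apply: projection_eq_range; rewrite // rP' rP.
Qed.

Section Inclusion.
Variables (E : innerModType A) (P : 'L(E)) (N : submodule E).
Hypotheses (sP : adj P = P) (PN : forall x, submod_set N (P x)).
Hypothesis NP : forall x, submod_set N x -> P x = x.

Lemma val_adjointable :
  exists S : E -> submod_of N,
    forall (x : submod_of N) y, inner (submod_val x) y = inner x (S y).
Proof.
exists (fun y => SubmodOf (asboolT (PN y))) => x y.
rewrite -[RHS]/(inner (submod_val x) (P y)) -{1}(NP (asboolW (submod_valP x))).
by rewrite adjP sP.
Qed.

Definition inclL : 'L(submod_of N, E) := AdjOp val_adjointable.

Lemma val_adj_incl y : val (adj inclL y) = P y.
Proof.
pose S y := SubmodOf (asboolT (PN y)) : submod_of N.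
suff -> : adj inclL y = S y by [].
apply: inner_inj => x; rewrite -adjP.
rewrite -[LHS]/(inner (submod_val x) y) -[RHS]/(inner (submod_val x) (P y)).
by rewrite -{1}(NP (asboolW (submod_valP x))) adjP sP.
Qed.

(** Hence the components of the unitary [U] in the block form are the adjoints of the two
    inclusions. *)
Lemma corestrL_incl : corestrL P N = adj inclL.
Proof.
apply: xget_unique => [x|S SP]; first exact: val_adj_incl.
by apply: adjop_ext => x; apply: val_inj; rewrite SP val_adj_incl.
Qed.

Lemma incl_adj : inclL \oL adj inclL = P.
Proof. by apply: adjop_ext => x; exact: val_adj_incl. Qed.

Lemma adj_incl : adj inclL \oL inclL = id_adjop _.
Proof.
apply: adjop_ext => x; apply: val_inj.
by rewrite [LHS]val_adj_incl; exact: (NP (asboolW (submod_valP x))).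
Qed.

End Inclusion.

End Submodules.

(** * Compression along an isometry *)

Section Compression.
Variables (R : realType) (A : cstarAlgType R).
Implicit Types E F G : innerModType A.

Lemma oL_addl E F G (S S' : 'L(F, G)) (T : 'L(E, F)) :
  (S + S') \oL T = S \oL T + S' \oL T.
Proof. exact: adjop_ext. Qed.

Lemma oL_addr E F G (S : 'L(F, G)) (T T' : 'L(E, F)) :
  S \oL (T + T') = S \oL T + S \oL T'.
Proof. by apply: adjop_ext => x /=; rewrite adjopD. Qed.

Lemma oL_scalel E F G z (S : 'L(F, G)) (T : 'L(E, F)) :
  (z *: S) \oL T = z *: (S \oL T).
Proof. exact: adjop_ext. Qed.

Lemma oL_scaler E F G z (S : 'L(F, G)) (T : 'L(E, F)) :
  S \oL (z *: T) = z *: (S \oL T).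
Proof. by apply: adjop_ext => x /=; rewrite adjopZ. Qed.

Lemma oL_assoc E F G K (S : 'L(G, K)) (T : 'L(F, G)) (U : 'L(E, F)) :
  S \oL (T \oL U) = S \oL T \oL U.
Proof. exact: adjop_ext. Qed.

Section Isometry.
Variables (E F : innerModType A) (J : 'L(F, E)) (P : 'L(E)).
Hypotheses (JJ : J \oL adj J = P) (JK : adj J \oL J = id_adjop F).

(** [J] is an isometry with range projection [P]. [compr] is multiplicative on the operators
    commuting with [P]; [extend] embeds L(F) as the corner of [P], sending the identity to [P]. *)
Definition compr (X : 'L(E)) : 'L(F) := adj J \oL X \oL J.
Definition extend (S : 'L(F)) : 'L(E) := J \oL S \oL adj J.

Lemma incl_adjK x : adj J (J x) = x.
Proof. by rewrite -[LHS]/((adj J \oL J) x) JK. Qed.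

Lemma incl_adjE x : J (adj J x) = P x.
Proof. by rewrite -JJ. Qed.

Lemma proj_incl x : P (J x) = J x.
Proof. by rewrite -incl_adjE incl_adjK. Qed.

Lemma adj_proj x : adj J (P x) = adj J x.
Proof. by rewrite -incl_adjE incl_adjK. Qed.

Lemma comprM X Y : compr X * compr Y = compr (X * P * Y).
Proof. by apply: adjop_ext => x /=; rewrite incl_adjE. Qed.

Lemma comprD X Y : compr (X + Y) = compr X + compr Y.
Proof. by rewrite /compr oL_addr oL_addl. Qed.

Lemma compr1 : compr 1 = 1.
Proof. by apply: adjop_ext => x; exact: incl_adjK. Qed.

Lemma compr_adj X : adj (compr X) = compr (adj X).
Proof. by rewrite /compr !adj_comp adjK oL_assoc. Qed.

Lemma extendK S : compr (extend S) = S.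
Proof.
apply: adjop_ext => x.
by rewrite -[LHS]/(adj J (J (S (adj J (J x))))) !incl_adjK.
Qed.

Lemma extend_compr X : extend (compr X) = P * X * P.
Proof. by apply: adjop_ext => x /=; rewrite !incl_adjE. Qed.

Lemma extendM S T : extend S * extend T = extend (S * T).
Proof.
apply: adjop_ext => x.
by rewrite -[LHS]/(J (S (adj J (J (T (adj J x)))))) incl_adjK.
Qed.

Lemma extend_adj S : adj (extend S) = extend (adj S).
Proof. by rewrite /extend !adj_comp adjK oL_assoc. Qed.

Lemma extendP S : extend S * P = extend S.
Proof.
by apply: adjop_ext => x; rewrite -[LHS]/(J (S (adj J (P x)))) adj_proj.
Qed.

Lemma Pextend S : P * extend S = extend S.
Proof. by apply: adjop_ext => x /=; rewrite proj_incl. Qed.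

Lemma comprMP X Y : GRing.comm X P -> compr X * compr Y = compr (X * Y).
Proof.
move=> XP; rewrite comprM XP; apply: adjop_ext => x.
by rewrite -[LHS]/(adj J (P (X (Y (J x))))) adj_proj.
Qed.

Lemma invL_compr X Y : GRing.comm X P -> X * Y = 1 -> Y * X = 1 ->
  invL (compr X) = compr Y.
Proof.
move=> XP XY YX; have YP : GRing.comm Y P.
  by rewrite /GRing.comm -[LHS]mulr1 -XY !mulrA -(mulrA Y) -XP mulrA YX mul1r.
have cXY : compr X * compr Y = 1 by rewrite comprMP // XY compr1.
apply: xget_unique => [|S [SX XS]].
  by split=> //; rewrite comprMP // YX compr1.
by rewrite -[LHS]mulr1 -cXY mulrA SX mul1r.
Qed.

Lemma comprX X n : GRing.comm X P -> compr X ^+ n = compr (X ^+ n).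
Proof.
move=> XP; elim: n => [|n IHn]; first by rewrite !expr0 compr1.
by rewrite !exprS IHn comprMP.
Qed.

Lemma extendX S n : extend S ^+ n.+1 = extend (S ^+ n.+1).
Proof.
elim: n => [|n IHn]; first by rewrite !expr1.
by rewrite exprS IHn extendM -exprS.
Qed.

End Isometry.

End Compression.

Section MatchedBlock.
Variables (R : realType) (A : cstarAlgType R) (H : hilbertModType A).
Implicit Types (P Q S T X b : 'L(H)).

Lemma positiveLP T : positiveL T <-> pos T.
Proof.
split=> [[S ->]|/pos_sqrt[S [/pos_sa sS <- _]]]; first exact: (pos_starM S).
by exists S; rewrite -[adj S]/(star S) sS.
Qed.

Lemma rootL_eq n T S : pos S -> S ^+ n = T ->
  (forall S', pos S' -> S' ^+ n = T -> S' = S) -> rootL n T = S.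
Proof.
move=> S0 ST uniqS; apply: xget_unique; first by split=> //; exact/positiveLP.
by move=> S' [/positiveLP S'0 S'T]; apply: uniqS.
Qed.

(* A root in L(F) is extended by [1 - P] to a root in L(H), where positivity is
   understood and uniqueness is available. *)
Lemma rootL_compr n (F : innerModType A) (J : 'L(F, H)) P X b :
    J \oL adj J = P -> adj J \oL J = id_adjop F -> (0 < n)%N ->
    pos (b - 1) -> b ^+ n = X -> commutant X b ->
    X * (1 - P) = 1 - P -> GRing.comm X P ->
  rootL n (compr J X) = compr J b.
Proof.
move=> JJ JK n0 b1 bX cb XN XP; have bP := cb _ XP.
have PP : P * P = P.
  apply: adjop_ext => x.
  by rewrite -[LHS]/(P (P x)) -(incl_adjE JJ x) (proj_incl JJ JK).
have sP : star P = P by rewrite -[LHS]/(adj P) -JJ adj_comp adjK.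
apply: xget_unique.
  split; last by rewrite (comprX JJ JK) // bX.
  (* [positiveL] in L(F) asks for a factor in L(F): the compression of a square root of [b], which
     again commutes with [P]. *)
  have [s [/pos_sa ss s2 cs]] := pos_sqrt (ge1_pos b1).
  exists (compr J s);
    rewrite compr_adj -[adj s]/(star s) ss (comprMP JJ JK) ?s2 //.
  exact: cs.
move=> S [[K SK] Sn].
pose S' := extend J S + (1 - P).
have NN : (1 - P) * (1 - P) = 1 - P.
  by rewrite mulrBr mulr1 mulrBl mul1r PP subrr subr0.
have S'0 : pos S'.
  apply: posD; last by apply: proj_pos; rewrite ?starB ?star1 ?sP.
  have -> : extend J S = star (extend J K) * extend J K.
    by rewrite SK -(extendM JK) -extend_adj.
  exact: pos_starM.
have S'n : S' ^+ n = X.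
  rewrite -(prednK n0) orth_expr //.
  - rewrite (extendX JK) prednK // Sn (extend_compr JJ) -XP -mulrA PP.
    by rewrite -[RHS]mulr1 -[in RHS](subrK P 1) mulrDr XN addrC.
  - by rewrite mulrBr mulr1 (extendP JJ JK) subrr.
  - by rewrite mulrBl mul1r (Pextend JJ JK) subrr.
have S'b : S' = b.
  apply: (ge1_root_unique n0 b1 S'0); last by rewrite S'n.
  by apply: cb; rewrite -S'n; apply/commr_sym/commrX.
rewrite -S'b comprD.
have -> : compr J (1 - P) = 0.
  apply: adjop_ext => x; rewrite -[LHS]/(adj J (J x + -1 *: P (J x))).
  by rewrite (proj_incl JJ JK) scaleN1r subrr adjop0.
by rewrite addr0 (extendK JK).
Qed.

End MatchedBlock.

Section MatchedProjection.
Variables (R : realType) (A : cstarAlgType R) (H : hilbertModType A).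
Implicit Types (P Q M S T X b e : 'L(H)).

Lemma rs_scale (t : R) T : rs 'L(H) t * T = t%:C%C *: T.
Proof. exact: adjop_ext. Qed.

Lemma adjM S T : adj (S * T) = adj T * adj S.
Proof. exact: (starM S T). Qed.

Lemma adjB S T : adj (S - T) = adj S - adj T.
Proof. exact: (starB S T). Qed.

Lemma adj1 : adj (1 : 'L(H)) = 1.
Proof. exact: (star1 'L(H)). Qed.

(** On R(Q) the inverse of [B] is [(b + 1) e] and that of [B (B + 1)] is [e]. The four blocks are
    therefore the terms in the expansion of [g e g^*]: [(b + 1) e (b + 1)], [(b + 1) e W],
    [W^* e (b + 1)] and [W^* e W]. *)
Lemma matched_proj_blockE P Q b e :
    Q * Q = Q -> adj P = P -> P * P = P -> P * Q = Q -> Q * P = P ->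
    let W := Q - P in
    pos (b - 1) -> b * b = 1 + W * adj W -> commutant (1 + W * adj W) b ->
    b * (b + 1) * e = 1 -> e * (b * (b + 1)) = 1 ->
    commutant (b * (b + 1)) e ->
    let g := P * (b + 1) + adj W in
  matched_proj_block Q = rs 'L(H) 2^-1 * (g * e * adj g).
Proof.
move=> QQ sP PP PQ QP W b1 bb cb Fe eF ce g.
have PW : P * W = W by rewrite mulrBr PQ PP.
have WP : W * P = 0 by rewrite mulrBl QP PP subrr.
have sWP : adj W * P = adj W.
  by rewrite -[in RHS]PW adjM sP.
have PsW : P * adj W = 0.
  by rewrite -{1}sP -adjM WP; exact: (star0 'L(H)).
pose N := nullL (adj Q).
have sN : adj (1 - P) = 1 - P by rewrite adjB adj1 sP.
have P1 x : submod_set (rangeL Q) (P x).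
  by exists (P x) => //; rewrite -[RHS]/(P x) -[in RHS]QP.
have P2 x : submod_set (rangeL Q) x -> P x = x.
  by move=> [y _ <-]; rewrite -[RHS]/(Q y) -[in RHS]PQ.
have N1 x : submod_set N ((1 - P) x).
  rewrite /N /=; have : adj Q * (1 - P) = 0.
    by rewrite mulrBr mulr1 -[X in _ - _ * X]sP -adjM PQ subrr.
  by move=> /(congr1 (fun T : 'L(H) => T x)).
have N2 x : submod_set N x -> (1 - P) x = x.
  move=> Nx; have Qx : adj Q x = 0 by exact: Nx.
  rewrite -[LHS]/(x + -1 *: P x) scaleN1r; have -> : P x = 0.
    by rewrite -sP -QP adjM -[LHS]/(adj P (adj Q x)) Qx adjop0.
  by rewrite subr0.
have rP : rprojL Q = P by apply: rprojL_eq.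
have [J1 J1E [JJ1 JK1]] : exists2 J1 : 'L(submod_of (rangeL Q), H),
    (forall x, J1 x = submod_val x) /\ corestrL P (rangeL Q) = adj J1 &
    J1 \oL adj J1 = P /\ adj J1 \oL J1 = id_adjop _.
  exists (inclL sP P1 P2); first by split=> //; exact: corestrL_incl.
  by split; [exact: incl_adj | exact: adj_incl].
have [J2 J2E [JJ2 JK2]] : exists2 J2 : 'L(submod_of N, H),
    (forall x, J2 x = submod_val x) /\ corestrL (1 - P) N = adj J2 &
    J2 \oL adj J2 = 1 - P /\ adj J2 \oL J2 = id_adjop _.
  exists (inclL sN N1 N2); first by split=> //; exact: corestrL_incl.
  by split; [exact: incl_adj | exact: adj_incl].
have WE : restrL W N (rangeL Q) = adj J1 \oL W \oL J2.
  have WJ x : val ((adj J1 \oL W \oL J2) x) = W (val x).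
    rewrite -[LHS]/(submod_val (adj J1 (W (J2 x)))) -J1E.1 J2E.1.
    by rewrite (incl_adjE JJ1) -[P (W _)]/((P * W) (val x)) PW.
  apply: xget_unique => // S SW; apply: adjop_ext => x; apply: val_inj.
  by rewrite SW WJ.
rewrite /matched_proj_block rP J1E.2 J2E.2 WE.
set a := adj J1 \oL W \oL J2.
have aE : adj a = adj J2 \oL adj W \oL J1.
  by rewrite /a !adj_comp adjK oL_assoc.
have NsW : (1 - P) * adj W = adj W by rewrite mulrBl mul1r PsW subr0.
have WN : W * (1 - P) = W by rewrite mulrBr mulr1 WP subr0.
have aa : a \oL adj a + 1 = compr J1 (1 + W * adj W).
  rewrite comprD (compr1 JK1) addrC; congr (_ + _).
  rewrite aE /a /compr -!oL_assoc (oL_assoc J2) JJ2.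
  by congr (_ \oL _); rewrite !oL_assoc -[W \oL _]/(W * (1 - P)) WN.
have XP : GRing.comm (1 + W * adj W) P.
  by rewrite /GRing.comm mulrDl mulrDr mul1r mulr1 mulrA PW -mulrA sWP.
have bP : GRing.comm b P := cb _ XP.
have bSP : GRing.comm (b + 1) P by apply: comml_add => //; apply: comml_1.
have eP : GRing.comm e P by apply: ce; apply: comml_mul.
have rB : rootL 2 (a \oL adj a + 1) = compr J1 b.
  rewrite aa; apply: (rootL_compr JJ1 JK1 _ b1) => //; rewrite ?expr2 //.
  by rewrite mulrDl mul1r -mulrA mulrBr mulr1 sWP subrr mulr0 addr0.
have eb : GRing.comm e b.
  by apply: ce; apply: comml_mul => //; apply: comml_add => //; apply: comml_1.
have bSb : (b + 1) * b = b * (b + 1) by rewrite mulrDl mulrDr mul1r mulr1.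
have invB : invL (compr J1 b) = compr J1 ((b + 1) * e).
  apply: (invL_compr JJ1 JK1) => //; first by rewrite mulrA.
  by rewrite -mulrA eb mulrA bSb.
have BS : compr J1 b + 1 = compr J1 (b + 1) by rewrite comprD (compr1 JK1).
have invF : invL (compr J1 b * (compr J1 b + 1)) = compr J1 e.
  rewrite BS (comprMP JJ1 JK1) //; apply: (invL_compr JJ1 JK1) => //.
  exact: comml_mul.
rewrite rB invF invB BS (comprMP JJ1 JK1) // aE /block_conj !adjK.
rewrite !(oL_scalel, oL_addr, oL_scaler) -!scalerDr.
rewrite rs_scale -half_complex; congr (_ *: _).
have eS : e * (b + 1) = (b + 1) * e by rewrite mulrDl mulrDr eb mulr1 mul1r.
have K1 X : J1 \oL (compr J1 X \oL adj J1) = P * X * P.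
  apply: adjop_ext => x; rewrite -[LHS]/(J1 (adj J1 (X (J1 (adj J1 x))))).
  by rewrite !(incl_adjE JJ1).
have K2 X : J1 \oL (compr J1 X \oL a \oL adj J2) = P * X * P * W * (1 - P).
  apply: adjop_ext => x.
  rewrite -[LHS]/(J1 (adj J1 (X (J1 (adj J1 (W (J2 (adj J2 x)))))))).
  by rewrite !(incl_adjE JJ1) (incl_adjE JJ2).
have K3 X : J2 \oL (adj J2 \oL adj W \oL J1 \oL compr J1 X \oL adj J1) =
    (1 - P) * adj W * P * X * P.
  apply: adjop_ext => x.
  rewrite -[LHS]/(J2 (adj J2 (adj W (J1 (adj J1 (X (J1 (adj J1 x)))))))).
  by rewrite !(incl_adjE JJ1) (incl_adjE JJ2).
have K4 X : J2 \oL (adj J2 \oL adj W \oL J1 \oL compr J1 X \oL a \oL adj J2) =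
    (1 - P) * adj W * P * X * P * W * (1 - P).
  apply: adjop_ext => x.
  rewrite -[LHS]/(J2 (adj J2 (adj W (J1 (adj J1 (X (J1 (adj J1 (W (J2 (adj J2
    x))))))))))).
  by rewrite !(incl_adjE JJ1) !(incl_adjE JJ2).
rewrite K1 K2 K3 K4 NsW sWP -!(mulrA _ P W) PW -!(mulrA _ W (1 - P)) WN.
have -> : adj g = (b + 1) * P + W.
  have sb : adj b = b := pos_sa (ge1_pos b1).
  rewrite /g; have -> : adj (P * (b + 1) + adj W) =
    adj (P * (b + 1)) + adj (adj W).
    exact: adjD.
  rewrite adjM adjK sP; have -> : adj (b + 1) = adj b + adj 1 by exact: adjD.
  by rewrite sb adj1.
have -> : g * e * ((b + 1) * P + W) = P * (b + 1) * (e * (b + 1)) * P +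
    P * (b + 1) * e * W + (adj W * (e * (b + 1)) * P + adj W * e * W).
  by rewrite /g; ncring.
by rewrite eS !mulrA.
Qed.

Lemma matched_proj_spec Q : Q * Q = Q ->
  let M := matched_proj Q in
  [/\ adj M = M, M * M = M & pos (M * Q * M - M)].
Proof.
move=> QQ M; rewrite /M /matched_proj; case: asboolP => [[_ sQ]|_].
  by split=> //; rewrite QQ QQ subrr; exact: pos0.
have [P [sP PP PQ QP]] := range_projection QQ.
have [b [e [b1 bb cb [Fe eF ce] MP]]] := matched_projection sP PP PQ QP.
by rewrite (matched_proj_blockE QQ sP PP PQ QP b1 bb cb Fe eF ce).
Qed.

Lemma inf_eq_limit (E : set R) (d : R) :
  (forall r, E r -> d <= r) ->
  (forall eps, 0 < eps -> exists2 r, E r & r <= d + eps) -> inf E = d.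
Proof.
move=> Ed dE; have [r0 Er0 _] := dE 1 ltr01.
have lbE : has_lbound E by exists d.
apply/eqP; rewrite eq_le; apply/andP; split.
  apply/ler_addgt0Pr => eps /dE[r Er rd]; apply: le_trans rd.
  exact: ge_inf.
by apply: lb_le_inf; [exists r0 | exact: Ed].
Qed.

End MatchedProjection.

Theorem theorem4p2 (R : realType) (A : cstarAlgType R) (H : hilbertModType A)
    (Q1 Q2 : 'L(H)) (idemQ1 : idempotentL Q1) (idemQ2 : idempotentL Q2) :
  let M1 := matched_proj Q1 in
  let M2 := matched_proj Q2 in
  let T1 := M1 * Q1 * M1 in
  let T2 := M2 * Q2 * M2 in
  let alpha m n := normL (rootL m T1 - rootL n T2) in
  let beta m := normL (rootL m T1 - M2) in
  let gamma n := normL (M1 - rootL n T2) in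
  let pos := [set n : nat | (0 < n)%N] in
  [/\ normL (M1 - M2) = inf [set alpha m n | m in pos & n in pos],
      inf [set alpha m n | m in pos & n in pos] = inf [set beta m | m in pos]
    & inf [set beta m | m in pos] = inf [set gamma n | n in pos]].
Proof.
move=> M1 M2 T1 T2 alpha beta gamma pos_nat.
have roots (Q : 'L(H)) : idempotentL Q -> let M := matched_proj Q in
    let T := M * Q * M in
    [/\ star M = M, M * M = M & forall n, (0 < n)%N ->
      exists Y, [/\ pos (Y - 1), GRing.comm Y M, rootL n T = Y * M &
        normL (rootL n T - M) <= normL (T - M) / n%:R]].
  move=> QQ M T; have [sM MM TM] := matched_proj_spec QQ; split=> // n n0.
  have MT : M * T = T by rewrite /T !mulrA MM.
  have TM' : T * M = T by rewrite /T -!mulrA MM.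
  have [Y [Y1 YM YM0 YMn [uniq dist]]] := corner_root sM MM MT TM' TM n0.
  have rT : rootL n T = Y * M by apply: rootL_eq => // S S0 Sn; exact: uniq.
  by exists Y; rewrite rT.
have [sM1 MM1 root1] := roots _ idemQ1; have [sM2 MM2 root2] := roots _ idemQ2.
pose d := normL (M1 - M2).
have small (c eps : R) : 0 <= c -> 0 < eps ->
    exists2 n : nat, (0 < n)%N & c / n%:R <= eps.
  move=> c0 eps0; exists (Num.truncn (c / eps)).+1 => //.
  by rewrite ler_pdivrMr // mulrC -ler_pdivrMr // ltW // truncnS_gt.
(* A bare projection is [1 * M], so [beta] and [gamma] are bounded below by [proj_dist_le] with
   [Y2 = 1] and [Y1 = 1]. *)
have comm1 (M : 'L(H)) : GRing.comm (1 : 'L(H)) M.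
  by rewrite /GRing.comm mul1r mulr1.
have pos11 : pos (1 - 1 : 'L(H)) by rewrite subrr; exact: pos0.
have alpha_ge m n : (0 < m)%N -> (0 < n)%N -> d <= alpha m n.
  move=> m0 n0; have [Y1 [Y1_ge1 YM1 rT1 _]] := root1 m m0.
  have [Y2 [Y2_ge1 YM2 rT2 _]] := root2 n n0.
  rewrite /alpha rT1 rT2; exact: (proj_dist_le sM1 MM1 sM2 MM2).
have beta_ge m : (0 < m)%N -> d <= beta m.
  move=> m0; have [Y1 [Y1_ge1 YM1 rT1 _]] := root1 m m0.
  rewrite /beta rT1 -[M2]mul1r; exact: (proj_dist_le sM1 MM1 sM2 MM2).
have gamma_ge n : (0 < n)%N -> d <= gamma n.
  move=> n0; have [Y2 [Y2_ge1 YM2 rT2 _]] := root2 n n0.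
  rewrite /gamma rT2 -[M1]mul1r; exact: (proj_dist_le sM1 MM1 sM2 MM2).
have near1 eps : 0 < eps ->
    exists2 m, (0 < m)%N & normL (rootL m T1 - M1) <= eps.
  move=> eps0; have [m m0 le_m] := small _ _ (normL_ge0 (T1 - M1)) eps0.
  by exists m => //; have [Y [_ _ _ le_Y]] := root1 m m0;
    exact: le_trans le_Y le_m.
have near2 eps : 0 < eps ->
    exists2 n, (0 < n)%N & normL (rootL n T2 - M2) <= eps.
  move=> eps0; have [n n0 le_n] := small _ _ (normL_ge0 (T2 - M2)) eps0.
  by exists n => //; have [Y [_ _ _ le_Y]] := root2 n n0;
    exact: le_trans le_Y le_n.
have -> : inf [set alpha m n | m in pos_nat & n in pos_nat] = d.
  apply: inf_eq_limit => [_ [m m0 [n n0 <-]]|eps eps0]; first exact: alpha_ge.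
  have eps20 : 0 < eps / 2 by lra.
  have [m m0 le_m] := near1 _ eps20; have [n n0 le_n] := near2 _ eps20.
  exists (alpha m n); first by exists m => //; exists n.
  rewrite /alpha (_ : _ - _ =
    (rootL m T1 - M1) + (M1 - M2) - (rootL n T2 - M2));
    last by zmodule.
  have := normLD (rootL m T1 - M1 + (M1 - M2)) (- (rootL n T2 - M2)).
  by have := normLD (rootL m T1 - M1) (M1 - M2); rewrite normLN -/d; lra.
have -> : inf [set beta m | m in pos_nat] = d.
  apply: inf_eq_limit => [_ [m m0 <-]|eps eps0]; first exact: beta_ge.
  have [m m0 le_m] := near1 _ eps0; exists (beta m); first by exists m.
  rewrite /beta (_ : _ - _ = (rootL m T1 - M1) + (M1 - M2)); last by zmodule.
  by have := normLD (rootL m T1 - M1) (M1 - M2); rewrite -/d; lra.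
have -> : inf [set gamma n | n in pos_nat] = d.
  apply: inf_eq_limit => [_ [n n0 <-]|eps eps0]; first exact: gamma_ge.
  have [n n0 le_n] := near2 _ eps0; exists (gamma n); first by exists n.
  rewrite /gamma (_ : _ - _ = (M1 - M2) - (rootL n T2 - M2)); last by zmodule.
  by have := normLD (M1 - M2) (- (rootL n T2 - M2)); rewrite normLN -/d; lra.
by [].
Qed.
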